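(* Consider the parameterized linear-quadratic optimal control problem described in the context under assumptions (A1)--(A4). Let $(x^*,u^*,\lambda^* )$ be its optimal state, control and adjoint for parameters $(d,d_0,d_T)$, and let $(x_p^*,u_p^*,\lambda_p^* )$ be the optimal state, control and adjoint for parameters $(d,d_0+l_0,d_T+l_T)$, where $l_0\in\mathbb{R}^{n_x}$, $l_T\in\mathbb{R}^{n_d}$. Put $\delta x=x_p^*-x^*$, $\delta u=u_p^*-u^*$, $\delta\lambda=\lambda_p^*-\lambda^*$. Then there exists a constant $\Lambda_b(\sigma)>0$, independent of $T$, such that $$\|\delta x(t)\|+\|\delta u(t)\|+\|\delta\lambda(t)\|\le\Lambda_b(\sigma)\Big(\|l_0\|e^{-\rho_Z(\sigma)t}+\|l_T\|e^{-\rho_Z(\sigma)(T-t)}\Big),\qquad t\in[0,T],$$ where $\rho_Z(\sigma)=\gamma_Q/(2c_1(\sigma))$ and $\Lambda_b(\sigma)$ is given explicitly by $$\Lambda_b(\sigma)=\Big\{1+\frac{\lambda_H}{\gamma_R}+\Big(1+\frac{\lambda_B}{\gamma_R}\Big)(c_1(\sigma)+\lambda_G)\Big\}\max\Big\{c_Z(\sigma),\ \frac{c_Z^2(\sigma)\lambda_B^2\lambda_G}{2\rho_Z(\sigma)\gamma_R}\Big\},$$ with $c_1(\sigma),c_Z(\sigma)$ listed in the context.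
   Context: Norms: $\|\cdot\|$ is the Euclidean norm of vectors and the operator norm of matrices; $\|f\|_\infty=\sup_{t\in[0,T]}\|f(t)\|$. For symmetric matrices, $\preceq$ is the Loewner order. $\Phi_M(t,s)$ is the evolution operator of $\dot x(t)=M(t)x(t)$. $W_{A,B}(t_0,t_1)=\int_{t_0}^{t_1}\Phi_A(t_0,s)B(s)B^\top(s)\Phi_A^\top(t_0,s)\,ds$. Parameterized problem: given $d:[0,T]\to\mathbb{R}^{n_d}$ (bounded and measurable), $d_0\in\mathbb{R}^{n_x}$, $d_T\in\mathbb{R}^{n_d}$, minimize over $(u,x)$ ($u$ bounded measurable, $x$ the corresponding state) $$\frac12\int_0^T\begin{bmatrix}x\\ u\\ d\end{bmatrix}^\top\begin{bmatrix}Q&H^\top&G^\top\\ H&R&W^\top\\ G&W&0\end{bmatrix}\begin{bmatrix}x\\ u\\ d\end{bmatrix}dt+\frac12\begin{bmatrix}x(T)\\ d_T\end{bmatrix}^\top\begin{bmatrix}Q_T&G_T^\top\\ G_T&0\end{bmatrix}\begin{bmatrix}x(T)\\ d_T\end{bmatrix}$$ subject to $\dot x(t)=A(t)x(t)+B(t)u(t)+C(t)d(t)$ on $(0,T]$, $x(0)=d_0$ (differential equations in the integrated/mild sense). Here $A(t)\in\mathbb{R}^{n_x\times n_x}$, $B(t)\in\mathbb{R}^{n_x\times n_u}$, $H(t)\in\mathbb{R}^{n_u\times n_x}$, $G(t)\in\mathbb{R}^{n_d\times n_x}$, $W(t)\in\mathbb{R}^{n_d\times n_u}$, $C(t)\in\mathbb{R}^{n_x\times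 n_d}$, $G_T\in\mathbb{R}^{n_d\times n_x}$, and $Q(t),R(t),Q_T$ are symmetric. The adjoint of the optimal pair solves $\dot\lambda^*=-A^\top\lambda^*-Qx^*-H^\top u^*-G^\top d$, $\lambda^*(T)=Q_Tx^*(T)+G_T^\top d_T$. The optimal control is taken in its pointwise representation $u^*=-R^{-1}(Hx^*+B^\top\lambda^*+W^\top d)$. Assumptions. (A1) $A,B,Q,H,R$ are continuous on $[0,T]$ with $\|A\|_\infty\le\lambda_A$, $\|B\|_\infty\le\lambda_B$, $\|Q\|_\infty\le\lambda_Q$, $\|H\|_\infty\le\lambda_H$, $\|R\|_\infty\le\lambda_R$, for positive constants independent of $T$. (A2) (Uniform complete controllability) There are $\sigma\in(0,T)$ and constants $\alpha_0,\alpha_1,\beta_0,\beta_1>0$ (possibly depending on $\sigma$) such that for every $t_0\in[0,T-\sigma]$ there is $t_1\in[t_0,t_0+\sigma]$ with $\alpha_0I\preceq W_{A,B}(t_0,t_1)\preceq\alpha_1I$ and $\beta_0I\preceq\Phi_A(t_1,t_0)W_{A,B}(t_0,t_1)\Phi_A^\top(t_1,t_0)\preceq\beta_1I$. (A3) There are $\gamma_R,\gamma_Q>0$ independent of $T$ with $R(t)\succeq\gamma_RI$ and $Q(t)-H^\top(t)R^{-1}(t)H(t)\succeq\gamma_QI$ for all $t\in[0,T]$, and $\gamma_QI\preceq Q_T\preceq\lambda_QI$. (A4) $G,W,C$ are continuous with $\|G\|_\infty\le\lambda_G$, $\|W\|_\infty\le\lambda_W$, $\|C\|_\infty\le\lambda_C$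 for positive constants independent of $T$, and $\|G_T\|\le\lambda_G$. Constants: $\kappa=\lambda_A+\lambda_B\lambda_H/\gamma_R$; $\alpha_1'=\frac{\lambda_B^2(e^{2\kappa\sigma}-1)}{2\kappa}$; $\alpha_0'=\Big(\frac{2}{\alpha_0}+\frac{\lambda_H^2}{\gamma_R^2\lambda_A}\big(1+\frac{\alpha_1}{\alpha_0}\big)^2(e^{2\lambda_A\sigma}-1)\Big)^{-1}$; $\tilde\alpha_0=\frac{1-e^{-2\kappa\sigma}}{2\kappa}$; $\tilde\alpha_1=\frac{e^{2\kappa\sigma}-1}{2\kappa}$; $c_0(\sigma)=\min\Big\{2\kappa\Big(\frac{\lambda_B^2}{\gamma_R}\big(1+\frac{\tilde\alpha_1}{\tilde\alpha_0}\big)^2+\frac{1}{\gamma_Q\tilde\alpha_0^2}\Big)^{-1},\Big(\frac{\lambda_B^2}{2\gamma_R\kappa}+\frac1{\gamma_Q}\Big)^{-1}\Big\}e^{-2\kappa\sigma}$; $c_1(\sigma)=\max\Big\{\frac{1}{2\kappa}\Big(\big(\lambda_Q+\frac{\lambda_H^2}{\gamma_R}\big)\big(1+\frac{\alpha_1'}{\alpha_0'}\big)^2+\frac{\lambda_R\lambda_B^2}{(\alpha_0')^2}\Big),\big(\lambda_Q+\frac{\lambda_H^2}{\gamma_R}\big)\big(1+\frac1{2\kappa}\big)\Big\}e^{2\kappa\sigma}$; $c_Z(\sigma)=\sqrt{c_1(\sigma)/c_0(\sigma)}$. *)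

(* Defs.v *)
From mathcomp Require Import all_boot all_order all_algebra.
From mathcomp Require Import all_classical all_reals all_analysis.
Import Order.TTheory GRing.Theory Num.Theory numFieldNormedType.Exports.

Set Implicit Arguments.
Unset Strict Implicit.
Unset Printing Implicit Defensive.

Local Open Scope classical_set_scope.
Local Open Scope ring_scope.

Section Norms.
Context {R : realType}.

(* The norm that the library puts on matrices is the max norm, hence the
   Euclidean norm and the induced operator norm below. *)
Definition vnorm {n} (v : 'cV[R]_n) : R := Num.sqrt (\sum_i v i 0 ^+ 2).

Definition opnorm {m n} (M : 'M[R]_(m, n)) : R :=
  sup [set vnorm (M *m v) | v in [set v : 'cV[R]_n | vnorm v <= 1]].

(* Extended-real valued, so that a finite upper bound really bounds M. *)
Definition sup_opnorm {m n} (T : R) (M : R -> 'M[R]_(m, n)) : \bar R :=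
  ereal_sup [set (opnorm (M t))%:E | t in `[0, T]].

Definition qform {n} (M : 'M[R]_n) (v : 'cV[R]_n) : R := (v^T *m M *m v) 0 0.

Definition loewner_le {n} (M N : 'M[R]_n) : Prop :=
  forall v : 'cV[R]_n, qform M v <= qform N v.

End Norms.

Section Integration.
Context {R : realType}.

(* The reals with the Lebesgue sigma-algebra, i.e. the completion of the
   Borel one, on which completed_lebesgue_measure is defined. *)
Definition lebesgueTypeR := caratheodory_type ((wlength (@idfun R))^*)%mu.

Definition mxint {m n} (D : set R) (F : R -> 'M[R]_(m, n)) : 'M[R]_(m, n) :=
  \matrix_(i, j) \int[completed_lebesgue_measure]_(s in D) F s i j.

Definition bounded_measurable {n} (T : R) (f : R -> 'cV[R]_n) : Prop :=
  (forall i, measurable_fun (`[0, T] : set lebesgueTypeR)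
               (fun t : lebesgueTypeR => f t i 0)) /\
  (exists K : R, forall t, t \in `[0, T] -> vnorm (f t) <= K).

(* Phi t s is the evolution operator of x' = M x on [0, T]; the equation
   is in integrated form and also covers t < s. *)
Definition evolution_operator {n} (T : R) (M : R -> 'M[R]_n)
    (Phi : R -> R -> 'M[R]_n) : Prop :=
  forall s, s \in `[0, T] ->
    [/\ Phi s s = 1%:M,
        {within `[0, T], continuous (fun t => Phi t s)} &
        forall t1 t2, t1 \in `[0, T] -> t2 \in `[0, T] -> t1 <= t2 ->
          Phi t2 s - Phi t1 s = mxint `[t1, t2] (fun r => M r *m Phi r s)].

(* W_{A,B}(t0, t1), where Phi is the evolution operator of A. *)
Definition gramian {n m} (Phi : R -> R -> 'M[R]_n) (B : R -> 'M[R]_(n, m))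
    (t0 t1 : R) : 'M[R]_n :=
  mxint `[t0, t1] (fun s => Phi t0 s *m B s *m (B s)^T *m (Phi t0 s)^T).

End Integration.

Record lq_data (R : realType) (nx nu nd : nat) := LQData {
  mA : R -> 'M[R]_nx;
  mB : R -> 'M[R]_(nx, nu);
  mC : R -> 'M[R]_(nx, nd);
  mQ : R -> 'M[R]_nx;
  mH : R -> 'M[R]_(nu, nx);
  mR : R -> 'M[R]_nu;
  mG : R -> 'M[R]_(nd, nx);
  mW : R -> 'M[R]_(nd, nu);
  mQT : 'M[R]_nx;
  mGT : 'M[R]_(nd, nx)
}.

Section Problem.
Context {R : realType} {nx nu nd : nat}.
Variables (T : R) (P : lq_data R nx nu nd).

Definition symmetric_weights : Prop :=
  (forall t, t \in `[0, T] -> (mQ P t)^T = mQ P t /\ (mR P t)^T = mR P t) /\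
  (mQT P)^T = mQT P.

Definition stage_matrix (t : R) : 'M[R]_(nx + (nu + nd)) :=
  block_mx (mQ P t)                (row_mx (mH P t)^T (mG P t)^T)
           (col_mx (mH P t) (mG P t)) (block_mx (mR P t) (mW P t)^T
                                                (mW P t) 0).

Definition terminal_matrix : 'M[R]_(nx + nd) :=
  block_mx (mQT P) (mGT P)^T (mGT P) 0.

Definition cost (d : R -> 'cV[R]_nd) (dT : 'cV[R]_nd)
    (x : R -> 'cV[R]_nx) (u : R -> 'cV[R]_nu) : R :=
  2^-1 * (\int[completed_lebesgue_measure]_(t in `[0%R, T])
            qform (stage_matrix t) (col_mx (x t) (col_mx (u t) (d t))))
  + 2^-1 * qform terminal_matrix (col_mx (x T) dT).

Definition state_eq (d : R -> 'cV[R]_nd) (d0 : 'cV[R]_nx)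
    (x : R -> 'cV[R]_nx) (u : R -> 'cV[R]_nu) : Prop :=
  {within `[0, T], continuous x} /\
  forall t, t \in `[0, T] ->
    x t = d0 + mxint `[0, t] (fun s => mA P s *m x s + mB P s *m u s
                                       + mC P s *m d s).

Definition feasible (d : R -> 'cV[R]_nd) (d0 : 'cV[R]_nx)
    (x : R -> 'cV[R]_nx) (u : R -> 'cV[R]_nu) : Prop :=
  bounded_measurable T u /\ state_eq d d0 x u.

Definition optimal (d : R -> 'cV[R]_nd) (d0 : 'cV[R]_nx) (dT : 'cV[R]_nd)
    (x : R -> 'cV[R]_nx) (u : R -> 'cV[R]_nu) : Prop :=
  feasible d d0 x u /\
  forall x' u', feasible d d0 x' u' -> cost d dT x u <= cost d dT x' u'.

(* Backward equation integrated from t to T. *)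
Definition adjoint_eq (d : R -> 'cV[R]_nd) (dT : 'cV[R]_nd)
    (x : R -> 'cV[R]_nx) (u : R -> 'cV[R]_nu) (lam : R -> 'cV[R]_nx) : Prop :=
  {within `[0, T], continuous lam} /\
  forall t, t \in `[0, T] ->
    lam t = mQT P *m x T + (mGT P)^T *m dT
            + mxint `[t, T] (fun s => (mA P s)^T *m lam s + mQ P s *m x s
                                      + (mH P s)^T *m u s + (mG P s)^T *m d s).

(* An optimal control is only determined almost everywhere; this selects
   the representative for which the stationarity condition holds at every
   time. *)
Definition pointwise_control (d : R -> 'cV[R]_nd)
    (x : R -> 'cV[R]_nx) (u : R -> 'cV[R]_nu) (lam : R -> 'cV[R]_nx) : Prop :=
  forall t, t \in `[0, T] ->
    u t = - (invmx (mR P t) *m (mH P t *m x t + (mB P t)^T *m lam t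
                                + (mW P t)^T *m d t)).

Definition optimal_triple (d : R -> 'cV[R]_nd) (d0 : 'cV[R]_nx)
    (dT : 'cV[R]_nd) (x : R -> 'cV[R]_nx) (u : R -> 'cV[R]_nu)
    (lam : R -> 'cV[R]_nx) : Prop :=
  [/\ optimal d d0 dT x u, adjoint_eq d dT x u lam &
      pointwise_control d x u lam].

End Problem.

Record lq_bounds (R : realType) := LQBounds {
  lamA : R; lamB : R; lamQ : R; lamH : R; lamR : R;
  lamG : R; lamW : R; lamC : R;
  gamR : R; gamQ : R;
  alpha0 : R; alpha1 : R; beta0 : R; beta1 : R;
  sigma : R
}.

Definition bounds_pos (R : realType) (c : lq_bounds R) : Prop :=
  [/\ [/\ 0 < lamA c, 0 < lamB c, 0 < lamQ c, 0 < lamH c & 0 < lamR c],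
      [/\ 0 < lamG c, 0 < lamW c & 0 < lamC c],
      0 < gamR c /\ 0 < gamQ c,
      [/\ 0 < alpha0 c, 0 < alpha1 c, 0 < beta0 c & 0 < beta1 c] &
      0 < sigma c].

Section Assumptions.
Context {R : realType} {nx nu nd : nat}.
Variables (c : lq_bounds R) (T : R) (P : lq_data R nx nu nd).

Definition bounded_coefficients : Prop :=
  [/\ {within `[0, T], continuous (mA P)} /\
        (sup_opnorm T (mA P) <= (lamA c)%:E)%E,
      {within `[0, T], continuous (mB P)} /\
        (sup_opnorm T (mB P) <= (lamB c)%:E)%E,
      {within `[0, T], continuous (mQ P)} /\
        (sup_opnorm T (mQ P) <= (lamQ c)%:E)%E,
      {within `[0, T], continuous (mH P)} /\
        (sup_opnorm T (mH P) <= (lamH c)%:E)%E &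
      {within `[0, T], continuous (mR P)} /\
        (sup_opnorm T (mR P) <= (lamR c)%:E)%E].

(* For continuous A the evolution operator Phi exists and is unique on
   [0, T], so the quantifier on Phi merely names it. *)
Definition uniformly_completely_controllable : Prop :=
  sigma c < T /\
  exists Phi, evolution_operator T (mA P) Phi /\
    forall t0, t0 \in `[0, T - sigma c] ->
    exists2 t1, t1 \in `[t0, t0 + sigma c] &
      let W := gramian Phi (mB P) t0 t1 in
      let W1 := Phi t1 t0 *m W *m (Phi t1 t0)^T in
      [/\ loewner_le (alpha0 c)%:M W, loewner_le W (alpha1 c)%:M,
          loewner_le (beta0 c)%:M W1 & loewner_le W1 (beta1 c)%:M].

Definition strongly_convex_weights : Prop :=
  (forall t, t \in `[0, T] ->
     loewner_le (gamR c)%:M (mR P t) /\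
     loewner_le (gamQ c)%:M
       (mQ P t - (mH P t)^T *m invmx (mR P t) *m mH P t)) /\
  (loewner_le (gamQ c)%:M (mQT P) /\ loewner_le (mQT P) (lamQ c)%:M).

Definition bounded_parameter_coefficients : Prop :=
  [/\ {within `[0, T], continuous (mG P)} /\
        (sup_opnorm T (mG P) <= (lamG c)%:E)%E,
      {within `[0, T], continuous (mW P)} /\
        (sup_opnorm T (mW P) <= (lamW c)%:E)%E,
      {within `[0, T], continuous (mC P)} /\
        (sup_opnorm T (mC P) <= (lamC c)%:E)%E &
      opnorm (mGT P) <= lamG c].

End Assumptions.

Section Constants.
Context {R : realType}.
Variable c : lq_bounds R.

Definition kappa : R := lamA c + lamB c * lamH c / gamR c.

Definition alpha1' : R :=
  lamB c ^+ 2 * (expR (2 * kappa * sigma c) - 1) / (2 * kappa).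

Definition alpha0' : R :=
  (2 / alpha0 c
   + lamH c ^+ 2 / (gamR c ^+ 2 * lamA c) * (1 + alpha1 c / alpha0 c) ^+ 2
     * (expR (2 * lamA c * sigma c) - 1))^-1.

Definition talpha0 : R := (1 - expR (- (2 * kappa * sigma c))) / (2 * kappa).

Definition talpha1 : R := (expR (2 * kappa * sigma c) - 1) / (2 * kappa).

Definition c0 : R :=
  Num.min
    (2 * kappa * (lamB c ^+ 2 / gamR c * (1 + talpha1 / talpha0) ^+ 2
                  + 1 / (gamQ c * talpha0 ^+ 2))^-1)
    (lamB c ^+ 2 / (2 * gamR c * kappa) + 1 / gamQ c)^-1
  * expR (- (2 * kappa * sigma c)).

Definition c1 : R :=
  Num.max
    (1 / (2 * kappa)
     * ((lamQ c + lamH c ^+ 2 / gamR c) * (1 + alpha1' / alpha0') ^+ 2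
        + lamR c * lamB c ^+ 2 / alpha0' ^+ 2))
    ((lamQ c + lamH c ^+ 2 / gamR c) * (1 + 1 / (2 * kappa)))
  * expR (2 * kappa * sigma c).

Definition cZ : R := Num.sqrt (c1 / c0).

Definition rhoZ : R := gamQ c / (2 * c1).

Definition Lambda_b : R :=
  (1 + lamH c / gamR c + (1 + lamB c / gamR c) * (c1 + lamG c))
  * Num.max cZ (cZ ^+ 2 * lamB c ^+ 2 * lamG c / (2 * rhoZ * gamR c)).

End Constants.

(* Main.v *)
Require Import Defs.
From mathcomp Require Import all_boot all_order all_algebra.
From mathcomp Require Import all_classical all_reals all_analysis.
From mathcomp Require Import measurable_realfun ring lra.
Import Order.TTheory GRing.Theory Num.Theory numFieldNormedType.Exports.

(* The data d enters both problems alike, so the difference (x, u, l) of the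
   two optimal triples satisfies the homogeneous Hamiltonian system
   x' = A x + B u, l' = - A^T l - Q x - H^T u, R u = - (H x + B^T l), with
   x(0) = l0 and l(T) = QT x(T) + GT^T lT; optimality itself plays no further
   role.

   When lT = 0, the value V = l.x satisfies V' <= - gamQ |x|^2, and it lies
   between c0 |x|^2 and c1 |x|^2: the upper bound comes from comparing the
   trajectory with one steered to 0 by the Gramian of (A, B), or with the
   uncontrolled one near T; the lower bound from a Lyapunov function with a
   cut-off in time.  Hence |x| decays at rate rhoZ = gamQ / (2 c1) and
   |l| <= c1 |x|.

   All these trajectories are (X q, L q), where (X, L) is the matrix solution
   with X(T) = 1 and L(T) = QT, and X(t) is invertible.  In general, put
   g = l - L X^-1 x.  The Wronskian of two trajectories is constant, so
   xi.g(t) = (X(T) X(t)^-1 xi).(GT^T lT), which bounds g by duality, and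
   variation of constants, (X^-1 x)' = - X^-1 B R^-1 B^T g, bounds x. *)

Set Implicit Arguments.
Unset Strict Implicit.
Unset Printing Implicit Defensive.

Local Open Scope classical_set_scope.
Local Open Scope ring_scope.

(** * Euclidean geometry *)

(** The obstacle is the terminal term GT^T lT: with it l.x may be negative at T, so it is no
    Lyapunov function. Decay is therefore proved for the homogeneous terminal condition only and
    then transferred. The matrix L X^-1 solves the Riccati differential equation, yet that nonlinear
    equation never appears: (X, L) solves a linear one, which has a solution on all of [0, T].

    The transition matrix X(t) X(s)^-1 decays forward in time. Its transpose carries GT^T lT back
    from T, so g decays backward at the same rate. In the variation of constants the two rates
    multiply to exp(-rho (t-s)) exp(-rho (T-s)), whose integral over s <= t is at most exp(-rho
    (T-t)) / (2 rho); this is the denominator in [Lambda_b].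

    The upper bound is proved in the stronger form 2 l.xi <= l.x + c1 |xi|^2 for every xi: xi = x
    bounds the value, and xi = l / c1 then bounds l. The comparison trajectories are open loop and
    grow at rate lamA; their costs are enlarged to [c1], which is built with the larger rate
    [kappa]. *)

Section DotProduct.
Context {R : realType}.

Definition dot {n} (u v : 'cV[R]_n) : R := (u^T *m v) 0 0.

Lemma dotE n (u v : 'cV[R]_n) : dot u v = \sum_i u i 0 * v i 0.
Proof. by rewrite /dot mxE; apply: eq_bigr => i _; rewrite mxE. Qed.

Lemma dotC n (u v : 'cV[R]_n) : dot u v = dot v u.
Proof. by rewrite !dotE; apply: eq_bigr => i _; rewrite mulrC. Qed.

Lemma dotDl n (u v w : 'cV[R]_n) : dot (u + v) w = dot u w + dot v w.
Proof. by rewrite /dot linearD mulmxDl mxE. Qed.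

Lemma dotDr n (u v w : 'cV[R]_n) : dot w (u + v) = dot w u + dot w v.
Proof. by rewrite !(dotC w) dotDl. Qed.

Lemma dotNl n (u v : 'cV[R]_n) : dot (- u) v = - dot u v.
Proof. by rewrite /dot linearN mulNmx mxE. Qed.

Lemma dotNr n (u v : 'cV[R]_n) : dot u (- v) = - dot u v.
Proof. by rewrite !(dotC u) dotNl. Qed.

Lemma dotZl n a (u v : 'cV[R]_n) : dot (a *: u) v = a * dot u v.
Proof. by rewrite /dot linearZ -scalemxAl mxE. Qed.

Lemma dotZr n a (u v : 'cV[R]_n) : dot u (a *: v) = a * dot u v.
Proof. by rewrite !(dotC u) dotZl. Qed.

Lemma dot0l n (u : 'cV[R]_n) : dot 0 u = 0.
Proof. by rewrite -(scale0r 0) dotZl mul0r. Qed.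

Lemma dot0r n (u : 'cV[R]_n) : dot u 0 = 0.
Proof. by rewrite dotC dot0l. Qed.

Lemma dot_mulmxr m n (M : 'M[R]_(m, n)) u v : dot u (M *m v) = dot (M^T *m u) v.
Proof. by rewrite /dot trmx_mul trmxK mulmxA. Qed.

Lemma dot_mulmxl m n (M : 'M[R]_(m, n)) u v : dot (M *m u) v = dot u (M^T *m v).
Proof. by rewrite dot_mulmxr trmxK. Qed.

Lemma dot_ge0 n (u : 'cV[R]_n) : 0 <= dot u u.
Proof. by rewrite dotE sumr_ge0// => i _; rewrite -expr2 sqr_ge0. Qed.

Lemma dot_eq0 n (u : 'cV[R]_n) : dot u u = 0 -> u = 0.
Proof.
rewrite dotE => /eqP; rewrite psumr_eq0; last by move=> i _; rewrite -expr2 sqr_ge0.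
move=> /allP h; apply/matrixP => i j; rewrite ord1 mxE.
by have := h i (mem_index_enum i); rewrite /= mulf_eq0 orbb => /eqP.
Qed.

Lemma qformE n (M : 'M[R]_n) v : qform M v = dot v (M *m v).
Proof. by rewrite /qform /dot mulmxA. Qed.

Lemma qform_scalar n a (v : 'cV[R]_n) : qform a%:M v = a * dot v v.
Proof. by rewrite qformE mul_scalar_mx dotZr. Qed.

Lemma vnorm_ge0 n (v : 'cV[R]_n) : 0 <= vnorm v.
Proof. exact: sqrtr_ge0. Qed.

Lemma sqr_vnorm n (v : 'cV[R]_n) : vnorm v ^+ 2 = dot v v.
Proof.
rewrite sqr_sqrtr ?dotE; first by apply: eq_bigr => i _; rewrite expr2.
by rewrite sumr_ge0// => i _; rewrite sqr_ge0.
Qed.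

Lemma vnorm_le n (v : 'cV[R]_n) a : 0 <= a -> dot v v <= a ^+ 2 -> vnorm v <= a.
Proof. by move=> a0; rewrite -sqr_vnorm ler_sqr ?nnegrE ?vnorm_ge0. Qed.

Lemma vnorm0_eq0 n (v : 'cV[R]_n) : vnorm v = 0 -> v = 0.
Proof. by move=> h; apply: dot_eq0; rewrite -sqr_vnorm h expr0n. Qed.

Lemma vnorm0 n : vnorm (0 : 'cV[R]_n) = 0.
Proof. by apply/eqP; rewrite -sqrf_eq0 sqr_vnorm dot0l. Qed.

Lemma vnormN n (v : 'cV[R]_n) : vnorm (- v) = vnorm v.
Proof.
by apply/eqP; rewrite -(@eqrXn2 _ 2) ?vnorm_ge0// !sqr_vnorm dotNl dotNr opprK.
Qed.

Lemma vnormZ n a (v : 'cV[R]_n) : vnorm (a *: v) = `|a| * vnorm v.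
Proof.
apply/eqP; rewrite -(@eqrXn2 _ 2) ?vnorm_ge0 ?mulr_ge0 ?vnorm_ge0//.
by rewrite exprMn real_normK ?num_real// !sqr_vnorm dotZl dotZr mulrA expr2.
Qed.

Lemma dot_le_vnorm n (u v : 'cV[R]_n) : dot u v <= vnorm u * vnorm v.
Proof.
have [/vnorm0_eq0 ->|u0] := eqVneq (vnorm u) 0; first by rewrite dot0l vnorm0 mul0r.
have [/vnorm0_eq0 ->|v0] := eqVneq (vnorm v) 0; first by rewrite dot0r vnorm0 mulr0.
have gt0 : 0 < vnorm u * vnorm v by rewrite mulr_gt0// lt_neqAle eq_sym ?u0 ?v0 vnorm_ge0.
have := dot_ge0 (vnorm v *: u - vnorm u *: v).
rewrite !(dotDl, dotDr, dotNl, dotNr, dotZl, dotZr) -!sqr_vnorm (dotC v u).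
set d := dot u v; move: gt0; set a := vnorm u; set b := vnorm v => gt0 h.
have : 0 <= (a * b) * (a * b - d) by lra.
by rewrite pmulr_rge0// subr_ge0.
Qed.

Lemma ler_vnormD n (u v : 'cV[R]_n) : vnorm (u + v) <= vnorm u + vnorm v.
Proof.
apply: vnorm_le; first by rewrite addr_ge0 ?vnorm_ge0.
rewrite dotDl !dotDr -!sqr_vnorm (dotC v u).
by have := dot_le_vnorm u v; lra.
Qed.

Lemma vnorm_le_dual n (v : 'cV[R]_n) a : 0 <= a ->
  (forall u, dot u v <= vnorm u * a) -> vnorm v <= a.
Proof.
move=> a0 /(_ v); rewrite -sqr_vnorm expr2.
have [->//|v0] := eqVneq (vnorm v) 0.
by rewrite ler_pM2l// lt_neqAle eq_sym v0 vnorm_ge0.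
Qed.

(** Shows that the set under the [sup] in [opnorm] is bounded above, so that [opnorm] really is an
    upper bound. The constant is crude: Cauchy-Schwarz on each row, then the sum of the row
    norms. *)
Lemma vnorm_mulmx_bounded m n (M : 'M[R]_(m, n)) :
  exists2 K, 0 <= K & forall v, vnorm (M *m v) <= K * vnorm v.
Proof.
pose K := \sum_i vnorm (row i M)^T.
exists K; first by rewrite sumr_ge0// => i _; rewrite vnorm_ge0.
move=> v; apply: vnorm_le.
  by rewrite mulr_ge0 ?vnorm_ge0// sumr_ge0// => i _; rewrite vnorm_ge0.
have rowE i : (M *m v) i 0 = dot (row i M)^T v.
  by rewrite dotE mxE; apply: eq_bigr => j _; rewrite !mxE.
rewrite dotE; under eq_bigr do rewrite rowE -expr2.
have sq i : dot (row i M)^T v ^+ 2 <= (vnorm (row i M)^T) ^+ 2 * vnorm v ^+ 2.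
  rewrite -exprMn -(real_normK (num_real (dot _ _))).
  rewrite ler_sqr ?nnegrE ?mulr_ge0 ?vnorm_ge0// ler_norml dot_le_vnorm andbT.
  by rewrite lerNl -dotNl; have := dot_le_vnorm (- (row i M)^T) v; rewrite vnormN.
rewrite exprMn (le_trans (ler_sum _ (fun i _ => sq i)))// -mulr_suml.
rewrite ler_wpM2r ?sqr_ge0// expr2 /K mulr_suml ler_sum// => i _.
rewrite expr2 ler_wpM2l ?vnorm_ge0// (bigD1 i)//= lerDl sumr_ge0// => j _.
exact: vnorm_ge0.
Qed.

Lemma vnorm_mulmx_le m n (M : 'M[R]_(m, n)) v :
  vnorm (M *m v) <= opnorm M * vnorm v.
Proof.
have [K K0 hK] := vnorm_mulmx_bounded M.
have ub w : vnorm w <= 1 -> vnorm (M *m w) <= opnorm M.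
  move=> w1; apply: ub_le_sup; last by exists w.
  exists K => _ [u u1 <-]; rewrite (le_trans (hK u))//.
  by rewrite -[leRHS]mulr1 ler_wpM2l.
have [/vnorm0_eq0 ->|v0] := eqVneq (vnorm v) 0; first by rewrite mulmx0 !vnorm0 mulr0.
have gt0 : 0 < vnorm v by rewrite lt_neqAle eq_sym v0 vnorm_ge0.
have := ub ((vnorm v)^-1 *: v).
rewrite -scalemxAr !vnormZ ger0_norm ?invr_ge0 ?vnorm_ge0// mulVf// => /(_ (lexx _)).
by rewrite ler_pdivrMl// mulrC.
Qed.

Lemma sup_opnorm_mulmx_le m n (T : R) (M : R -> 'M[R]_(m, n)) l t v :
  t \in `[0, T] -> (sup_opnorm T M <= l%:E)%E -> vnorm (M t *m v) <= l * vnorm v.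
Proof.
move=> tT hM; apply: (le_trans (vnorm_mulmx_le _ _)).
rewrite ler_wpM2r ?vnorm_ge0// -lee_fin; apply: le_trans hM.
by apply: ereal_sup_ubound; exists t.
Qed.

Lemma vnorm_trmx_mulmx_le m n (M : 'M[R]_(m, n)) l : 0 <= l ->
  (forall v, vnorm (M *m v) <= l * vnorm v) ->
  forall v, vnorm (M^T *m v) <= l * vnorm v.
Proof.
move=> l0 hM v; apply: vnorm_le_dual => [|u]; first by rewrite mulr_ge0 ?vnorm_ge0.
rewrite dot_mulmxr trmxK (le_trans (dot_le_vnorm _ _))//.
by rewrite mulrA ler_wpM2r ?vnorm_ge0// mulrC hM.
Qed.

Lemma unitmx_injective n (M : 'M[R]_n) :
  (forall v : 'cV[R]_n, M *m v = 0 -> v = 0) -> M \in unitmx.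
Proof.
move=> h; rewrite -unitmx_tr -row_free_unit; apply: inj_row_free => v hv.
by rewrite -[v]trmxK (h v^T) ?trmx0// -[M]trmxK -trmx_mul hv trmx0.
Qed.

Lemma coercive_unitmx n (M : 'M[R]_n) a : 0 < a -> loewner_le a%:M M ->
  M \in unitmx.
Proof.
move=> a0 hM; apply: unitmx_injective => v Mv; apply: dot_eq0.
have := hM v; rewrite qform_scalar qformE Mv dot0r => h.
by apply/eqP; rewrite eq_le dot_ge0 andbT -(pmulr_rle0 _ a0).
Qed.

Lemma coercive_invmx_le n (M : 'M[R]_n) a v : 0 < a -> loewner_le a%:M M ->
  vnorm (invmx M *m v) <= vnorm v / a.
Proof.
move=> a0 hM; set w := invmx M *m v.
have Mw : M *m w = v by rewrite /w mulKVmx// (coercive_unitmx a0).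
have := hM w; rewrite qform_scalar qformE Mw -sqr_vnorm => h.
have [->|w0] := eqVneq (vnorm w) 0; first by rewrite divr_ge0 ?vnorm_ge0 ?ltW.
have gt0 : 0 < vnorm w by rewrite lt_neqAle eq_sym w0 vnorm_ge0.
rewrite ler_pdivlMr// mulrC -(ler_pM2l gt0).
by rewrite mulrCA -expr2 (le_trans h)// dot_le_vnorm.
Qed.

(* Take y = l / a. *)
Lemma vnorm_le_of_quadratic n (l : 'cV[R]_n) a b : 0 < a -> 0 <= b ->
  (forall y, 2 * dot l y <= a * b ^+ 2 + a * dot y y) -> vnorm l <= a * b.
Proof.
move=> a0 b0 h; have := h (a^-1 *: l); rewrite dotZl !dotZr => h1.
have e : a * (a^-1 * (a^-1 * dot l l)) = a^-1 * dot l l by rewrite mulVKf ?gt_eqF.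
apply: vnorm_le; first by rewrite mulr_ge0 ?(ltW a0).
rewrite e in h1; have {h1} : a^-1 * dot l l <= a * b ^+ 2 by lra.
by rewrite ler_pdivrMl// => h2; rewrite exprMn [a ^+ 2]expr2 -mulrA.
Qed.

(** Positivity of the form at v - y gives 2 (M v).y <= v.(M v) + y.(M y), and both terms on the
    right are bounded by [a]. *)
Lemma vnorm_psd_mulmx_le n (M : 'M[R]_n) a : 0 < a -> M^T = M ->
  loewner_le 0 M -> loewner_le M a%:M ->
  forall v, vnorm (M *m v) <= a * vnorm v.
Proof.
move=> a0 sM M0 Ma v; apply: vnorm_le_of_quadratic; rewrite ?vnorm_ge0// => y.
have := M0 (v - y); have := Ma v; have := Ma y.
rewrite !qform_scalar !qformE mul0mx dot0r mulmxBr sqr_vnorm (dotC (M *m v) y).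
rewrite !(dotDl, dotDr, dotNl, dotNr).
have -> : dot v (M *m y) = dot y (M *m v) by rewrite dot_mulmxr sM dotC.
by lra.
Qed.

End DotProduct.

(** * Calculus of matrix-valued functions *)

Section MatrixCalculus.
Context {R : realType}.

(* Solutions on [0, T] are extended beyond both end points, so that this
   two-sided derivative makes sense on the closed interval. *)
Definition mder {m n} (F : R -> 'M[R]_(m, n)) (t : R) (D : 'M[R]_(m, n)) :=
  forall i j, is_derive t 1 (fun s => F s i j) (D i j).

Lemma mder_eq m n (F : R -> 'M[R]_(m, n)) t D D' : mder F t D -> D = D' -> mder F t D'.
Proof. by move=> h <-. Qed.

Lemma mder_cst m n (M : 'M[R]_(m, n)) t : mder (fun=> M) t 0.
Proof. by move=> i j; rewrite mxE; exact: is_derive_cst. Qed.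

Lemma mderD m n (F G : R -> 'M[R]_(m, n)) t DF DG :
  mder F t DF -> mder G t DG -> mder (fun s => F s + G s) t (DF + DG).
Proof.
move=> hF hG i j; rewrite mxE.
by under eq_fun do rewrite mxE; exact: is_deriveD.
Qed.

Lemma mderN m n (F : R -> 'M[R]_(m, n)) t DF :
  mder F t DF -> mder (fun s => - F s) t (- DF).
Proof.
move=> hF i j; rewrite mxE.
by under eq_fun do rewrite mxE; exact: is_deriveN.
Qed.

Lemma mderB m n (F G : R -> 'M[R]_(m, n)) t DF DG :
  mder F t DF -> mder G t DG -> mder (fun s => F s - G s) t (DF - DG).
Proof. by move=> hF hG; apply: mderD => //; exact: mderN. Qed.

Lemma mder_tr m n (F : R -> 'M[R]_(m, n)) t DF :
  mder F t DF -> mder (fun s => (F s)^T) t DF^T.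
Proof. by move=> hF i j; rewrite mxE; under eq_fun do rewrite mxE; exact: hF. Qed.

Lemma mderM m n p (F : R -> 'M[R]_(m, n)) (G : R -> 'M[R]_(n, p)) t DF DG :
  mder F t DF -> mder G t DG ->
  mder (fun s => F s *m G s) t (DF *m G t + F t *m DG).
Proof.
move=> hF hG i j; rewrite mxE [X in X + _]mxE [X in _ + X]mxE -big_split/=.
have -> : (fun s => (F s *m G s) i j) =
    \sum_(k < n) ((fun s => F s i k) * (fun s => G s k j)).
  by apply/funext => s; rewrite mxE fct_sumE.
apply: is_derive_sum => k; apply: is_derive_eq; first exact: is_deriveM.
by rewrite /GRing.scale/= addrC (mulrC (G t k j)).
Qed.

Lemma mderMl m n p (M : 'M[R]_(m, n)) (G : R -> 'M[R]_(n, p)) t DG :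
  mder G t DG -> mder (fun s => M *m G s) t (M *m DG).
Proof. by move=> h; apply: mder_eq (mderM (mder_cst M t) h) _; rewrite mul0mx add0r. Qed.

Lemma mderMr m n p (M : 'M[R]_(n, p)) (G : R -> 'M[R]_(m, n)) t DG :
  mder G t DG -> mder (fun s => G s *m M) t (DG *m M).
Proof. by move=> h; apply: mder_eq (mderM h (mder_cst M t)) _; rewrite mulmx0 addr0. Qed.

Lemma is_derive_cast (f : R -> R) (t d d' : R) :
  is_derive t 1 f d -> d = d' -> is_derive t 1 f d'.
Proof. by move=> h <-. Qed.

Lemma derive_dot n (u v : R -> 'cV[R]_n) t Du Dv : mder u t Du -> mder v t Dv ->
  is_derive t 1 (fun s => dot (u s) (v s)) (dot Du (v t) + dot (u t) Dv).
Proof.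
move=> hu hv; have := mderM (mder_tr hu) hv => /(_ 0 0).
by rewrite mxE.
Qed.

Lemma le_of_derive_le0 (f f' : R -> R) (a b : R) : a <= b ->
  (forall t : R, t \in `[a, b] -> is_derive t 1 f (f' t)) ->
  (forall t : R, t \in `[a, b] -> f' t <= 0) -> f b <= f a.
Proof.
move=> ab df f'0; have oc t : t \in `]a, b[ -> t \in `[a, b].
  by rewrite !in_itv/= => /andP[/ltW -> /ltW ->].
apply: (@ler0_derive1_le_cc _ f a b); rewrite ?in_itv/= ?lexx ?ab//.
- by move=> t /oc /df h; exact: ex_derive.
- by move=> t /oc h; have ? := df _ h; rewrite derive1E derive_val f'0.
- by apply: derivable_within_continuous => t /df h; exact: ex_derive.
Qed.

Lemma ge_of_derive_ge0 (f f' : R -> R) (a b : R) : a <= b ->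
  (forall t : R, t \in `[a, b] -> is_derive t 1 f (f' t)) ->
  (forall t : R, t \in `[a, b] -> 0 <= f' t) -> f a <= f b.
Proof.
move=> ab df f'0; rewrite -lerN2.
apply: (@le_of_derive_le0 (fun t => - f t) (fun t => - f' t)) => // t tab.
  by apply: is_deriveN; exact: df.
by rewrite oppr_le0 f'0.
Qed.

Lemma mder0_cst m n (F : R -> 'M[R]_(m, n)) (a b : R) : a <= b ->
  (forall t : R, t \in `[a, b] -> mder F t 0) -> F a = F b.
Proof.
move=> ab hF; apply/matrixP => i j; apply/eqP; rewrite eq_le; apply/andP; split.
  apply: (@ge_of_derive_ge0 (fun t => F t i j) (fun=> 0)) => // t tab.
  by have := hF t tab i j; rewrite mxE.
apply: (@le_of_derive_le0 (fun t => F t i j) (fun=> 0)) => // t tab.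
by have := hF t tab i j; rewrite mxE.
Qed.

Definition clamp (T t : R) : R := Num.max 0 (Num.min t T).

Lemma clamp_in (T t : R) : 0 <= T -> clamp T t \in `[0, T].
Proof. by move=> T0; rewrite in_itv/= /clamp le_max lexx/= ge_max T0 ge_min lexx orbT. Qed.

Lemma clamp_id (T t : R) : t \in `[0, T] -> clamp T t = t.
Proof.
rewrite in_itv/= /clamp => /andP[t0 tT].
by rewrite (min_idPl _)// (max_idPr _).
Qed.

Lemma continuous_clamp T : continuous (clamp T).
Proof.
move=> t; have h : {for t, continuous (id \min cst T)}.
  by apply: (@continuous_min R R id (cst T) t) => //; exact: cst_continuous.
exact: (@continuous_max R R (cst 0) (id \min cst T) t (@cst_continuous _ _ _ _) h).
Qed.

(* Continuity on [0, T], stated for the extension that is constant outside. *)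
Definition ccont T {m n} (F : R -> 'M[R]_(m, n)) :=
  forall i j, continuous (fun t => F (clamp T t) i j).

Lemma within_ccont (T : R) m n (F : R -> 'M[R]_(m, n)) : 0 <= T ->
  {within `[0, T], continuous F} -> ccont T F.
Proof.
move=> T0 cF i j t.
have FT : {within `[0, T], continuous (fun s => F s i j)}.
  apply: (@within_continuous_comp _ _ _ `[0, T]%classic F (fun M : 'M[R]_(m, n) => M i j)) => //.
  by move=> M _; exact: coord_continuous.
have /subspace_continuousP/(_ (clamp T t)) := FT.
move=> /(_ (clamp_in t T0)) h.
apply: (cvg_comp (clamp T) (fun s => F s i j) _ h) => A /= hA.
have hc : nbhs t (clamp T @^-1` [set s | s \in `[0, T] -> A s]) :=
  @continuous_clamp T t _ hA.
by apply: (@filterS _ (nbhs t) _ _ _ _ hc) => s; apply; exact: clamp_in.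
Qed.

Lemma mder_ccont T m n (F F' : R -> 'M[R]_(m, n)) : 0 <= T ->
  (forall t : R, t \in `[0, T] -> mder F t (F' t)) -> ccont T F.
Proof.
move=> T0 dF i j t; apply: (continuous_comp (g := fun s => F s i j)).
  exact: continuous_clamp.
apply: differentiable_continuous; apply/derivable1_diffP.
by have := dF _ (clamp_in t T0) i j => h; exact: ex_derive.
Qed.

Lemma ccont_cst T m n (M : 'M[R]_(m, n)) : ccont T (fun=> M).
Proof. by move=> i j; exact: cst_continuous. Qed.

Lemma ccontD T m n (F G : R -> 'M[R]_(m, n)) :
  ccont T F -> ccont T G -> ccont T (fun t => F t + G t).
Proof.
move=> cF cG i j t; under eq_fun do rewrite mxE.
by apply: cvgD; [exact: cF|exact: cG].
Qed.

Lemma ccontN T m n (F : R -> 'M[R]_(m, n)) : ccont T F -> ccont T (fun t => - F t).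
Proof.
by move=> cF i j t; under eq_fun do rewrite mxE; apply: cvgN; exact: cF.
Qed.

Lemma ccontB T m n (F G : R -> 'M[R]_(m, n)) :
  ccont T F -> ccont T G -> ccont T (fun t => F t - G t).
Proof. by move=> cF cG; apply: ccontD => //; exact: ccontN. Qed.

Lemma ccont_tr T m n (F : R -> 'M[R]_(m, n)) : ccont T F -> ccont T (fun t => (F t)^T).
Proof.
by move=> cF i j t; under eq_fun do rewrite mxE; exact: cF.
Qed.

Lemma ccontM T m n p (F : R -> 'M[R]_(m, n)) (G : R -> 'M[R]_(n, p)) :
  ccont T F -> ccont T G -> ccont T (fun t => F t *m G t).
Proof.
move=> cF cG i j t; under eq_fun do rewrite mxE.
apply: cvg_big => [|k _]; first exact: add_continuous.
by apply: cvgM; [exact: cF|exact: cG].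
Qed.

Lemma ccont_block T m1 m2 n1 n2 (F : R -> 'M[R]_(m1, n1)) (G : R -> 'M[R]_(m1, n2))
    (H : R -> 'M[R]_(m2, n1)) (K : R -> 'M[R]_(m2, n2)) :
  ccont T F -> ccont T G -> ccont T H -> ccont T K ->
  ccont T (fun t => block_mx (F t) (G t) (H t) (K t)).
Proof.
move=> cF cG cH cK i j.
case: (split_ordP i) => i' ->; case: (split_ordP j) => j' -> t.
- by under eq_fun do rewrite block_mxEul; exact: cF.
- by under eq_fun do rewrite block_mxEur; exact: cG.
- by under eq_fun do rewrite block_mxEdl; exact: cH.
- by under eq_fun do rewrite block_mxEdr; exact: cK.
Qed.

Lemma ccont_det T n (F : R -> 'M[R]_n) : ccont T F ->
  continuous (fun t => \det (F (clamp T t))).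
Proof.
move=> cF t; apply: cvg_big => [|s _]; first exact: add_continuous.
apply: cvgM; first exact: cvg_cst.
by apply: cvg_big => [|k _]; [exact: mul_continuous|exact: cF].
Qed.

(** Cramer's rule: an entry of the inverse is a cofactor divided by a nonvanishing determinant, and
    both are polynomials in the entries of F. *)
Lemma ccont_invmx T n (F : R -> 'M[R]_n) : 0 <= T ->
  (forall t : R, t \in `[0, T] -> F t \in unitmx) ->
  ccont T F -> ccont T (fun t => invmx (F t)).
Proof.
move=> T0 uF cF i j t; have uc s : F (clamp T s) \in unitmx by rewrite uF// clamp_in.
rewrite /invmx; under eq_fun do rewrite uc mxE.
apply: cvgM.
  apply: cvgV; last exact: ccont_det.
  by have := uc t; rewrite unitmxE unitfE.
have adjE s : (\adj (F (clamp T s))) i j =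
    (-1) ^+ (j + i) * \det (row' j (col' i (F (clamp T s)))) by rewrite mxE.
rewrite adjE; under eq_fun do rewrite adjE.
apply: cvgM; first exact: cvg_cst.
have cF' : ccont T (fun t => row' j (col' i (F t))).
  by move=> a b s; under eq_fun do rewrite !mxE; exact: cF.
exact: (ccont_det cF').
Qed.

Lemma primitive_exists (T : R) (f : R -> R) : continuous f ->
  exists F : R -> R, forall t : R, t \in `[0, T] -> is_derive t 1 F (f t).
Proof.
(* Integrating from -1, with integrability up to T + 1, makes every point of [0, T] interior, so the
   derivative is two-sided at 0 and T as well. *)
move=> cf; exists (fun x => (\int[lebesgue_measure]_(s in [set` `[(-1 : R), x]]) f s)%R) => t.
rewrite in_itv/= => /andP[t0 tT].
have int : (lebesgue_measure : {measure set (measurableTypeR R) -> \bar R}).-integrable `[-1, T + 1] (EFin \o f).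
  apply: continuous_compact_integrable; first exact: segment_compact.
  exact: continuous_subspaceT.
have tT1 : t < T + 1 by rewrite (le_lt_trans tT)// ltrDl.
have t1 : -1 < t by rewrite (lt_le_trans _ t0)// ltrN10.
have [d e] := continuous_FTC1_closed tT1 int t1 (cf t).
by rewrite -e derive1E; exact/derivableP.
Qed.

Lemma mprimitive_exists T m n (f : R -> 'M[R]_(m, n)) : ccont T f ->
  exists F : R -> 'M[R]_(m, n), forall t : R, t \in `[0, T] -> mder F t (f t).
Proof.
move=> cf; have h (ij : 'I_m * 'I_n) := primitive_exists T (cf ij.1 ij.2).
have [F hF] := choice h.
exists (fun t => \matrix_(i, j) F (i, j) t) => t tT i j.
under eq_fun do rewrite mxE.
by have := hF (i, j) t tT; rewrite /= clamp_id.
Qed.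

End MatrixCalculus.

(** * Integration with respect to the completed Lebesgue measure *)

Section CompletedIntegral.
Context {R : realType}.

(** The identity, seen as a map from the Lebesgue to the Borel sigma-algebra. Pushing the completed
    measure forward along it gives [lebesgue_measure], for which the fundamental theorem of calculus
    is stated. *)
Let toBorel (x : @lebesgueTypeR R) : measurableTypeR R := x.

Lemma measurable_toBorel : measurable_fun setT toBorel.
Proof. by move=> _ A mA; rewrite setTI; exact: sub_caratheodory. Qed.

Lemma measurable_itvL (a b : R) : measurable (`[a, b] : set (@lebesgueTypeR R)).
Proof.
have := measurable_toBorel measurableT.
by move=> /(_ `[a, b]%classic (measurable_itv _)); rewrite setTI.
Qed.

Lemma measurable_continuousL (D : set (@lebesgueTypeR R)) (f : R -> R) :
  continuous f -> measurable_fun D (f : @lebesgueTypeR R -> R).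
Proof.
move=> cf; apply: measurable_funTS.
apply: (@measurableT_comp _ _ _ _ _ _ (f : measurableTypeR R -> R) _ toBorel).
  exact: continuous_measurable_fun.
exact: measurable_toBorel.
Qed.

Lemma completed_itv_fin (a b : R) :
  ((@completed_lebesgue_measure R) (`[a, b]%classic) < +oo)%E.
Proof.
have -> : (@completed_lebesgue_measure R) `[a, b]%classic = lebesgue_measure `[a, b]%classic by [].
by rewrite lebesgue_measure_itv; case: ifP; rewrite ltry.
Qed.

Lemma bounded_integrableL (a b : R) (f : R -> R) (K : R) :
  measurable_fun (`[a, b] : set (@lebesgueTypeR R)) (f : @lebesgueTypeR R -> R) ->
  (forall t, t \in `[a, b] -> `|f t| <= K) ->
  (@completed_lebesgue_measure R).-integrable `[a, b] (EFin \o f).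
Proof.
move=> mf bf; apply: measurable_bounded_integrable => //.
- exact: measurable_itvL.
- exact: completed_itv_fin.
- exists K; split; first exact: num_real.
  by move=> M KM x /= xab; rewrite (le_trans (bf x _))// ltW.
Qed.

Lemma continuous_bounded_itv (a b : R) (f : R -> R) : continuous f ->
  exists K, forall t, t \in `[a, b] -> `|f t| <= K.
Proof.
move=> cf; have [ab|ba] := leP a b; last first.
  by exists 0 => t; rewrite in_itv/= => /andP[h1 h2]; move: (le_trans h1 h2); rewrite leNgt ba.
have cn : {within `[a, b], continuous (fun t => `|f t|)}.
  apply: continuous_subspaceT => t; apply: continuous_comp; first exact: cf.
  exact: norm_continuous.
by have [c _ hc] := EVT_max ab cn; exists `|f c|.
Qed.

Lemma Rintegral_continuous (a b : R) (f G : R -> R) : a <= b -> continuous f ->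
  (forall t : R, t \in `[a, b] -> is_derive t 1 G (f t)) ->
  \int[completed_lebesgue_measure]_(s in `[a, b]) f s = G b - G a.
Proof.
move=> ab cf dG; rewrite /Rintegral.
have [K hK] := continuous_bounded_itv a b cf.
have intf : (@completed_lebesgue_measure R).-integrable `[a, b] (EFin \o f).
  by apply: bounded_integrableL hK; exact: measurable_continuousL.
have mf : measurable_fun [set: measurableTypeR R] (EFin \o f).
  by apply/measurable_EFinP; exact: continuous_measurable_fun.
have push := @integral_pushforward _ _ _ _ _ toBorel measurable_toBorel
  (@completed_lebesgue_measure R) `[a, b]%classic (EFin \o f) mf intf (measurable_itv _).
rewrite -[X in fine X]push.
have -> : (\int[pushforward (@completed_lebesgue_measure R) toBorel]_(y in `[a, b]) (EFin \o f) y
   = \int[lebesgue_measure]_(y in `[a, b]) (f y)%:E)%E.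
  by apply: eq_measure_integral => [|mf1 A mA AD]; first exact: measurable_toBorel.
(* The fundamental theorem needs a nondegenerate interval; at a = b both sides vanish. *)
move: ab; rewrite le_eqVlt => /orP[/eqP <-|ab].
  by rewrite set_itv1 integral_set1 subrr.
have d1 (t : R) : t \in `[a, b] -> derivable G t 1 by move=> /dG h; exact: ex_derive.
have ct (t : R) : t \in `[a, b] -> {for t, continuous G}.
  by move=> /d1 h; apply: differentiable_continuous; exact/derivable1_diffP.
have oc (t : R) : t \in `]a, b[ -> t \in `[a, b].
  by rewrite !in_itv/= => /andP[/ltW -> /ltW ->].
rewrite (@continuous_FTC2 _ _ G)//.
- exact: continuous_subspaceT.
- split.
  + by move=> t /oc /d1.
  + by apply: cvg_at_right_filter; apply: ct; rewrite in_itv/= lexx ltW.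
  + by apply: cvg_at_left_filter; apply: ct; rewrite in_itv/= lexx ltW.
- by move=> t /oc h; have ? := dG _ h; rewrite derive1E derive_val.
Qed.

Lemma mxint_ccont (T a b : R) m n (F G : R -> 'M[R]_(m, n)) :
  0 <= a -> a <= b -> b <= T -> ccont T F ->
  (forall t : R, t \in `[0, T] -> mder G t (F t)) ->
  mxint `[a, b] F = G b - G a.
Proof.
move=> a0 ab bT cF dG; have T0 := le_trans a0 (le_trans ab bT).
have sub (t : R) : t \in `[a, b] -> t \in `[0, T].
  by rewrite !in_itv/= => /andP[h1 h2]; rewrite (le_trans a0)// (le_trans h2).
apply/matrixP => i j; rewrite !mxE.
have dG' (t : R) : t \in `[a, b] -> is_derive t 1 (fun t => G t i j) (F (clamp T t) i j).
  by move=> /sub tT; rewrite clamp_id//; exact: dG.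
have <- := Rintegral_continuous ab (cF i j) dG'.
by apply: eq_Rintegral => t; rewrite inE/= => /sub tT; rewrite clamp_id.
Qed.

(** The parameter d and each of the two controls need not be continuous. This class contains them
    and the continuous coefficients, is closed under sums and products, and consists of integrable
    functions, so the integrals of the two problems may be subtracted. *)
Definition mxbm (T : R) {m n} (F : R -> 'M[R]_(m, n)) := forall i j,
  measurable_fun (`[0, T] : set (@lebesgueTypeR R)) (fun t : @lebesgueTypeR R => F t i j)
  /\ exists K : R, forall t : R, t \in `[0, T] -> `|F t i j| <= K.

Lemma ccont_mxbm T m n (F : R -> 'M[R]_(m, n)) : ccont T F -> mxbm T F.
Proof.
move=> cF i j; split.
  have e : {in ([set` `[0, T]] : set (@lebesgueTypeR R)),
      (fun t : @lebesgueTypeR R => F (clamp T t) i j) =1 (fun t => F t i j)}.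
    by move=> t; rewrite inE/= => tT; rewrite clamp_id.
  have := eq_measurable_fun (fun t : @lebesgueTypeR R => F (clamp T t) i j) e. apply; exact: measurable_continuousL.
have [K hK] := continuous_bounded_itv 0 T (cF i j).
by exists K => t tT; have := hK t tT; rewrite clamp_id.
Qed.

Lemma bounded_measurable_mxbm T n (f : R -> 'cV[R]_n) :
  bounded_measurable T f -> mxbm T f.
Proof.
move=> [mf [K hK]] i j; rewrite ord1; split; first exact: mf.
exists K => t tT; apply: le_trans (hK t tT).
rewrite -sqrtr_sqr ler_wsqrtr// (bigD1 i)//= lerDl.
by apply: sumr_ge0 => k _; rewrite sqr_ge0.
Qed.

Lemma mxbmD T m n (F G : R -> 'M[R]_(m, n)) :
  mxbm T F -> mxbm T G -> mxbm T (fun t => F t + G t).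
Proof.
move=> hF hG i j; have [mF [K hK]] := hF i j; have [mG [L hL]] := hG i j.
split.
  have -> : (fun t : @lebesgueTypeR R => (F t + G t) i j) =
      (fun t => F t i j) \+ (fun t => G t i j) by apply/funext => t; rewrite mxE.
  exact: measurable_funD.
exists (K + L) => t tT; rewrite mxE (le_trans (ler_normD _ _))// lerD ?hK ?hL//.
Qed.

Lemma mxbmM T m n p (F : R -> 'M[R]_(m, n)) (G : R -> 'M[R]_(n, p)) :
  mxbm T F -> mxbm T G -> mxbm T (fun t => F t *m G t).
Proof.
move=> hF hG i j; split.
  have -> : (fun t : @lebesgueTypeR R => (F t *m G t) i j) =
      (fun t => \sum_k F t i k * G t k j) by apply/funext => t; rewrite mxE.
  by apply: measurable_sum => k; apply: measurable_funM; [apply hF | apply hG].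
have [K hK] := choice (fun k => (hF i k).2).
have [L hL] := choice (fun k => (hG k j).2).
exists (\sum_k K k * L k) => t tT; rewrite mxE (le_trans (ler_norm_sum _ _ _))//.
by apply: ler_sum => k _; rewrite normrM ler_pM ?hK ?hL.
Qed.

Lemma mxintB (T a b : R) n (F G : R -> 'cV[R]_n) :
  0 <= a -> b <= T -> mxbm T F -> mxbm T G ->
  mxint `[a, b] F - mxint `[a, b] G = mxint `[a, b] (fun t => F t - G t).
Proof.
move=> a0 bT hF hG.
have sub (t : R) : t \in `[a, b] -> t \in `[0, T].
  by rewrite !in_itv/= => /andP[h1 h2]; rewrite (le_trans a0)// (le_trans h2).
have int (H : R -> 'cV[R]_n) i j : mxbm T H ->
    (@completed_lebesgue_measure R).-integrable `[a, b] (EFin \o (fun t => H t i j)).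
  move=> hH; have [mH [K hK]] := hH i j.
  apply: (@bounded_integrableL _ _ _ K); last by move=> t /sub; exact: hK.
  by apply: measurable_funS mH => [|t]; [exact: measurable_itvL|exact: sub].
apply/matrixP => i j; rewrite !mxE -RintegralB//.
- by apply: eq_Rintegral => t _; rewrite !mxE.
- exact: measurable_itvL.
- exact: int.
- exact: int.
Qed.

End CompletedIntegral.

(** * Linear differential equations *)

Section LinearODE.
Context {R : realType}.

(** Both f + h and h - f are nonincreasing. With an explicit h this replaces the estimate of an
    integral of |f'|. *)
Lemma normr_sub_le_of_derive (f f' h h' : R -> R) (a b : R) : a <= b ->
  (forall t : R, t \in `[a, b] -> is_derive t 1 f (f' t)) ->
  (forall t : R, t \in `[a, b] -> is_derive t 1 h (h' t)) ->
  (forall t : R, t \in `[a, b] -> `|f' t| <= - h' t) ->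
  `|f a - f b| <= h a - h b.
Proof.
move=> ab df dh fh; rewrite ler_norml; apply/andP; split.
  have : f b + h b <= f a + h a; last by lra.
  apply: (@le_of_derive_le0 _ (fun t => f t + h t) (fun t => f' t + h' t)) => // t tab.
    by apply: is_deriveD; [exact: df|exact: dh].
  by have := fh t tab; rewrite ler_norml => /andP[_ ?]; lra.
have : f a - h a <= f b - h b; last by lra.
apply: (@ge_of_derive_ge0 _ (fun t => f t - h t) (fun t => f' t - h' t)) => // t tab.
  by apply: is_deriveB; [exact: df|exact: dh].
by have := fh t tab; rewrite ler_norml => /andP[? _]; lra.
Qed.

Lemma is_derive_expR_affine (a c k t : R) :
  is_derive t 1 (fun s => k * expR (a * s + c)) (a * (k * expR (a * t + c))).
Proof.
have h : is_derive t 1 (fun s : R => a * s + c) a.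
  by apply: is_derive_eq; rewrite /GRing.scale/=; ring.
have e := @is_derive1_comp _ expR (fun s => a * s + c) t _ _ (is_derive_expR _) h.
have e2 := is_deriveZ k e.
by apply: is_derive_eq; rewrite /GRing.scale/=; ring.
Qed.

Lemma exp2_small (c e : R) : 0 < e -> exists k : nat, c * 2 ^- k <= e.
Proof.
move=> e0; exists (Num.truncn (c / e)).+1.
rewrite ler_pdivrMr ?exprn_gt0// mulrC -ler_pdivrMr//.
apply: (le_trans (ltW (truncnS_gt _))).
by rewrite -natrX ler_nat ltnW// ltn_expl.
Qed.

(** With w k = 2 c 2^-k one has w k - w (k+1) = c 2^-k, so the intervals [z k - w k, z k + w k] are
    nested; the limit is the supremum of their left end points. *)
Lemma nested_limit (z : nat -> R) (c : R) :
  (forall k, `|z k.+1 - z k| <= c * 2 ^- k) ->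
  exists l, forall k, `|l - z k| <= 2 * c * 2 ^- k.
Proof.
move=> hz; pose w k := 2 * c * 2 ^- k; have wS k : w k - w k.+1 = c * 2 ^- k.
  by rewrite /w exprS invfM; field.
have up : {homo (fun k => z k - w k) : i j / (i <= j)%N >-> i <= j}.
  apply: homo_leq => [//|??? /le_trans h /h //|k].
  by have := hz k; rewrite ler_norml -wS => /andP[? _]; lra.
have dn : {homo (fun k => z k + w k) : i j / (i <= j)%N >-> j <= i}.
  apply: (@homo_leq _ _ (fun x y => y <= x)) => [//|y x v h1 h2|k]; first exact: le_trans h1.
  by have := hz k; rewrite ler_norml -wS => /andP[_ ?]; lra.
have w0 k : 0 <= w k.
  have := hz k; rewrite /w => h; have := le_trans (normr_ge0 _) h; rewrite -mulrA.
  by move=> ?; rewrite mulr_ge0.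
have hab i j : z i - w i <= z j + w j.
  have [ij|/ltnW ij] := leqP i j.
    by have := up _ _ ij; have := w0 j; move=> /=; lra.
  by have := dn _ _ ij; have := w0 i; move=> /=; lra.
exists (sup [set z k - w k | k in setT]) => k; rewrite ler_norml; apply/andP; split.
  suff : z k - w k <= sup [set z k - w k | k in setT] by rewrite /w; lra.
  by apply: ub_le_sup; [exists (z 0 + w 0) => _ [i _ <-]|exists k].
suff : sup [set z k - w k | k in setT] <= z k + w k by rewrite /w; lra.
by apply: ge_sup; [exists (z 0 - w 0), 0|move=> _ [i _ <-]].
Qed.

Lemma uniform_limit_ccont (T : R) m n (Z : nat -> R -> 'M[R]_(m, n)) (Y : R -> 'M[R]_(m, n)) (c : R) : 0 <= T ->
  (forall k, ccont T (Z k)) ->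
  (forall k (t : R), t \in `[0, T] -> forall i j, `|Y t i j - Z k t i j| <= c * 2 ^- k) ->
  ccont T Y.
Proof.
move=> T0 cZ hY i j t; apply/cvgrPdist_le => e e0.
have e3 : 0 < e / 3 by rewrite divr_gt0.
have [k hk] := exp2_small c e3.
have /cvgrPdist_le/(_ _ e3) := cZ k i j t.
apply: filterS => s hs.
have h1 := hY k _ (clamp_in t T0) i j; have h2 := hY k _ (clamp_in s T0) i j.
have -> : Y (clamp T t) i j - Y (clamp T s) i j =
  (Y (clamp T t) i j - Z k (clamp T t) i j) +
  ((Z k (clamp T t) i j - Z k (clamp T s) i j) - (Y (clamp T s) i j - Z k (clamp T s) i j)) by ring.
rewrite (le_trans (ler_normD _ _))//.
have := ler_normB (Z k (clamp T t) i j - Z k (clamp T s) i j) (Y (clamp T s) i j - Z k (clamp T s) i j).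
by lra.
Qed.

Lemma ccont_bounded (T : R) m n (F : R -> 'M[R]_(m, n)) : ccont T F ->
  exists2 K, 0 <= K & forall t : R, t \in `[0, T] -> forall i j, `|F t i j| <= K.
Proof.
move=> cF.
have h (ij : 'I_m * 'I_n) : exists K, forall t : R, t \in `[0, T] -> `|F t ij.1 ij.2| <= K.
  have [K hK] := continuous_bounded_itv 0 T (cF ij.1 ij.2).
  by exists K => t tT; have := hK t tT; rewrite clamp_id.
have [K hK] := choice h; exists (\sum_ij `|K ij|); first by rewrite sumr_ge0.
move=> t tT i j; rewrite (le_trans (hK (i, j) t tT))//.
by rewrite (bigD1 (i, j))//= (le_trans (ler_norm _))// lerDl sumr_ge0.
Qed.

Lemma mulmx_entry_le m n p (A : 'M[R]_(m, n)) (B : 'M[R]_(n, p)) a b :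
  (forall i j, `|A i j| <= a) -> (forall i j, `|B i j| <= b) ->
  forall i j, `|(A *m B) i j| <= n%:R * (a * b).
Proof.
move=> hA hB i j; rewrite mxE (le_trans (ler_norm_sum _ _ _))//.
rewrite -[n in n%:R]card_ord mulr_natl -sumr_const ler_sum// => k _.
by rewrite normrM ler_pM.
Qed.

Variables (T : R) (n m : nat) (K : R -> 'M[R]_n) (ZT : 'M[R]_(n, m)).
Hypotheses (T0 : 0 <= T) (cK : ccont T K).

(* Picard iteration from the final time; in the weight exp(2L(T-t)) the
   iteration map contracts by 1/2. *)
Lemma linear_ode_exists : exists Z : R -> 'M[R]_(n, m), Z T = ZT /\
  forall t : R, t \in `[0, T] -> mder Z t (K t *m Z t).
Proof.
(* A choice function must be total, hence the arbitrary value when F is not continuous. *)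
have primE (F : R -> 'M[R]_(n, m)) : exists G : R -> 'M[R]_(n, m),
    ccont T F -> forall t : R, t \in `[0, T] -> mder G t (F t).
  have [cF|ncF] := pselect (ccont T F); last by exists F.
  by have [G hG] := mprimitive_exists cF; exists G.
have [prim hprim] := choice primE.
pose step Z t := ZT + (prim (fun s => K s *m Z s) t - prim (fun s => K s *m Z s) T).
have step_der Z : ccont T Z -> forall t : R, t \in `[0, T] -> mder (step Z) t (K t *m Z t).
  move=> cZ t tT; have h := hprim _ (ccontM cK cZ) t tT.
  apply: mder_eq (mderD (mder_cst ZT t) (mderB h (mder_cst _ t))) _.
  by rewrite subr0 add0r.
have step_T Z : step Z T = ZT by rewrite /step subrr addr0.
pose Z := fix Z k := if k is k'.+1 then step (Z k') else fun=> 0.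
have cZ k : ccont T (Z k).
  by elim: k => [|k ih]; [exact: ccont_cst|exact: (mder_ccont T0 (step_der _ ih))].
have [a a0 ha] := ccont_bounded cK.
(* L bounds multiplication by K in the largest-entry norm; the summand 1 only keeps it positive.
   Integrating L exp(2 L (T - s)) from t to T gains the factor 1/2. *)
pose L := n%:R * a + 1; have L0 : 0 < L by rewrite ltr_wpDl// mulr_ge0.
have [C C0 hC] := ccont_bounded (ccontB (cZ 1) (cZ 0)).
have bnd k (t : R) : t \in `[0, T] -> forall i j,
    `|(Z k.+1 t - Z k t) i j| <= C * 2 ^- k * expR ((- (2 * L)) * t + 2 * L * T).
  elim: k t => [|k ih] t tT i j.
    rewrite (le_trans (hC t tT i j))// expr0 invr1 mulr1 -[leLHS]mulr1 ler_wpM2l//.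
    have -> : - (2 * L) * t + 2 * L * T = 2 * L * (T - t) by ring.
    rewrite -expR0 ler_expR mulr_ge0 ?mulr_ge0 ?(ltW L0)//.
    by move: tT; rewrite in_itv/= => /andP[_]; rewrite subr_ge0.
  have sub (s : R) : s \in `[t, T] -> s \in `[0, T].
    move: tT; rewrite !in_itv/= => /andP[t0 _] /andP[ts ->].
    by rewrite (le_trans t0).
  have tT' : t <= T by move: tT; rewrite in_itv/= => /andP[].
  have := @normr_sub_le_of_derive (fun s => (Z k.+2 s - Z k.+1 s) i j)
    (fun s => (K s *m (Z k.+1 s - Z k s)) i j)
    (fun s => C * 2 ^- k.+1 * expR (- (2 * L) * s + 2 * L * T))
    (fun s => - (2 * L) * (C * 2 ^- k.+1 * expR (- (2 * L) * s + 2 * L * T))) t T tT'.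
  rewrite /= !step_T subrr [X in _ - X]mxE subr0 => h.
  apply: (le_trans (h _ _ _)).
  - move=> s /sub sT; rewrite mulmxBr.
    exact: (mderB (step_der _ (cZ k.+1) s sT) (step_der _ (cZ k) s sT)).
  - by move=> s _; exact: is_derive_expR_affine.
  - move=> s /sub sT.
    rewrite (le_trans (mulmx_entry_le (ha s sT) (ih s sT) i j))//.
    set E := expR _; have E0 : 0 < E by exact: expR_gt0.
    rewrite exprS invfM mulrA.
    have : 0 <= C * 2 ^- k * E by rewrite !mulr_ge0 ?invr_ge0 ?exprn_ge0// ltW.
    by rewrite /L; nra.
  - by rewrite lerBlDr lerDl !mulr_ge0 ?invr_ge0 ?exprn_ge0 ?expR_ge0.
pose c := C * expR (2 * L * T).
have unif k (t : R) : t \in `[0, T] -> forall i j,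
    `|Z k.+1 t i j - Z k t i j| <= c * 2 ^- k.
  move=> tT i j; have := bnd k t tT i j; rewrite !mxE => /le_trans; apply.
  rewrite /c mulrAC ler_wpM2r ?invr_ge0 ?exprn_ge0// ler_wpM2l// ler_expR.
  by move: tT; rewrite in_itv/= => /andP[t0 _]; rewrite gerDr mulNr oppr_le0 !mulr_ge0// ltW.
have lim (p : R * ('I_n * 'I_m)) : exists l, p.1 \in `[0, T] -> forall k : nat,
    `|l - Z k p.1 p.2.1 p.2.2| <= 2 * c * 2 ^- k.
  have [tT|ntT] := boolP (p.1 \in `[0, T]); last by exists 0.
  have [|l hl] := @nested_limit (fun k => Z k p.1 p.2.1 p.2.2) c; last by exists l.
  by move=> k; exact: unif.
have [Y0 hY0] := choice lim.
pose Y t := \matrix_(i, j) Y0 (t, (i, j)) : 'M[R]_(n, m).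
have hY k (t : R) : t \in `[0, T] -> forall i j, `|(Y t - Z k t) i j| <= 2 * c * 2 ^- k.
  by move=> tT i j; rewrite !mxE; exact: (hY0 (t, (i, j)) tT k).
have cY : ccont T Y.
  apply: (uniform_limit_ccont T0 cZ) => k t tT i j.
  by have := hY k t tT i j; rewrite !mxE => h; exact: h.
(* Y is a pointwise limit with arbitrary values outside [0, T], so it need not have a two-sided
   derivative at the end points; [step Y] has one and agrees with Y on [0, T]. *)
exists (step Y); split=> // t tT; suff <- : Y t = step Y t by exact: step_der.
have c0 : 0 <= c by rewrite mulr_ge0 ?expR_ge0.
apply/matrixP => i j; apply/eqP; rewrite -subr_eq0 -normr_le0.
apply/ler_addgt0Pr => e e0; rewrite add0r.
(* The summand c bounds the distance from Y to the iterate k+1, up to 2^-k; the other summand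
   bounds, over a time at most T, the distance from that iterate to [step Y]. *)
have [k hk] := exp2_small (c + L * (2 * c) * T) e0; apply: le_trans hk.
have tT' : t <= T by move: tT; rewrite in_itv/= => /andP[].
have t0 : 0 <= t by move: tT; rewrite in_itv/= => /andP[].
have sub (s : R) : s \in `[t, T] -> s \in `[0, T].
  by rewrite !in_itv/= => /andP[ts ->]; rewrite (le_trans t0).
have := @normr_sub_le_of_derive (fun s => (step Y s - Z k.+1 s) i j)
    (fun s => (K s *m (Y s - Z k s)) i j)
    (fun s => - (L * (2 * c * 2 ^- k)) * s)
    (fun s => - (L * (2 * c * 2 ^- k))) t T tT'.
rewrite /= !step_T subrr [X in _ - X]mxE subr0 => h.
have {}h : `|(step Y t - step (Z k) t) i j| <=
    - (L * (2 * c * 2 ^- k)) * t - - (L * (2 * c * 2 ^- k)) * T.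
  apply: h => s /sub sT.
  - rewrite mulmxBr.
    exact: (mderB (step_der _ cY s sT) (step_der _ (cZ k) s sT)).
  - by apply: is_derive_eq; rewrite /GRing.scale/= mulr1.
  - rewrite opprK (le_trans (mulmx_entry_le (ha s sT) (hY k s sT) i j))//.
    rewrite mulrA ler_wpM2r ?mulr_ge0 ?invr_ge0 ?exprn_ge0//.
    by rewrite /L lerDl.
have hk1 := hY k.+1 t tT i j.
have -> : Y t i j - step Y t i j = (Y t - Z k.+1 t) i j - (step Y t - Z k.+1 t) i j.
  by rewrite !mxE; ring.
rewrite (le_trans (ler_normB _ _))// (le_trans (lerD hk1 h))//.
have -> : 2 * c * 2 ^- k.+1 = c * 2 ^- k by rewrite exprS invfM; field.
have : 0 <= L * (2 * c * 2 ^- k) * t by rewrite !mulr_ge0 ?invr_ge0 ?exprn_ge0 ?(ltW L0).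
by nra.
Qed.

End LinearODE.

(** * The Hamiltonian system *)

(** The integral of exp(2 a s) over s in [0, t]. *)
Definition expint {R : realType} (a t : R) : R := (expR (2 * a * t) - 1) / (2 * a).

Section HamiltonianSystem.
Context {R : realType} {nx nu : nat}.
Variables (T : R) (A : R -> 'M[R]_nx) (B : R -> 'M[R]_(nx, nu)).
Variables (Q : R -> 'M[R]_nx) (H : R -> 'M[R]_(nu, nx)) (Rm : R -> 'M[R]_nu).
Variable QT : 'M[R]_nx.
Variables la lb lq lh lr gr gq : R.

Hypothesis T0 : 0 <= T.
Hypotheses (la0 : 0 < la) (lb0 : 0 < lb) (lq0 : 0 < lq) (lh0 : 0 < lh).
Hypotheses (lr0 : 0 < lr) (gr0 : 0 < gr) (gq0 : 0 < gq).
Hypothesis symQ : forall t : R, t \in `[0, T] -> (Q t)^T = Q t.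
Hypothesis symR : forall t : R, t \in `[0, T] -> (Rm t)^T = Rm t.
Hypothesis symQT : QT^T = QT.
Hypothesis bndA : forall t : R, t \in `[0, T] -> forall v, vnorm (A t *m v) <= la * vnorm v.
Hypothesis bndB : forall t : R, t \in `[0, T] -> forall v, vnorm (B t *m v) <= lb * vnorm v.
Hypothesis bndQ : forall t : R, t \in `[0, T] -> forall v, vnorm (Q t *m v) <= lq * vnorm v.
Hypothesis bndH : forall t : R, t \in `[0, T] -> forall v, vnorm (H t *m v) <= lh * vnorm v.
Hypothesis bndR : forall t : R, t \in `[0, T] -> forall v, vnorm (Rm t *m v) <= lr * vnorm v.
Hypothesis coeR : forall t : R, t \in `[0, T] -> loewner_le gr%:M (Rm t).
Hypothesis coeQ : forall t : R, t \in `[0, T] ->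
  loewner_le gq%:M (Q t - (H t)^T *m invmx (Rm t) *m H t).
Hypotheses (QT_ge : loewner_le gq%:M QT) (QT_le : loewner_le QT lq%:M).

Local Notation kappa := (la + lb * lh / gr).

Definition ham (x : R -> 'cV[R]_nx) (u : R -> 'cV[R]_nu) (l : R -> 'cV[R]_nx) :=
  forall t : R, t \in `[0, T] ->
  [/\ mder x t (A t *m x t + B t *m u t),
      mder l t (- ((A t)^T *m l t) - Q t *m x t - (H t)^T *m u t) &
      Rm t *m u t = - (H t *m x t + (B t)^T *m l t)].

(** The polarized form of the stage cost with d = 0, that is, the bilinear form of the block matrix
    with rows (Q, H^T) and (H, R), without the factor 1/2. *)
Definition ell t (x : 'cV[R]_nx) (u : 'cV[R]_nu) y w :=
  dot x (Q t *m y) + dot u (H t *m y) + dot w (H t *m x) + dot u (Rm t *m w).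

(** The control variable that completes the square: in terms of v = u + R^-1 H x the stage cost is
    x.(Q - H^T R^-1 H) x + v.(R v), with no cross term. *)
Definition freeu t (x : 'cV[R]_nx) (u : 'cV[R]_nu) := u + invmx (Rm t) *m (H t *m x).

Lemma itv_sub (a b t : R) : 0 <= a -> b <= T -> t \in `[a, b] -> t \in `[0, T].
Proof.
by rewrite !in_itv/= => a0 bT /andP[h1 h2]; rewrite (le_trans a0)// (le_trans h2).
Qed.

Lemma Rm_unit t : t \in `[0, T] -> Rm t \in unitmx.
Proof. by move=> tT; apply: coercive_unitmx (coeR tT). Qed.

Lemma bnd_invR t v : t \in `[0, T] -> vnorm (invmx (Rm t) *m v) <= vnorm v / gr.
Proof. by move=> tT; apply: coercive_invmx_le => //; exact: coeR. Qed.

Lemma ell_sym t x u y w : t \in `[0, T] -> ell t x u y w = ell t y w x u.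
Proof.
move=> tT; rewrite /ell.
rewrite [dot x _]dot_mulmxr symQ// (dotC (Q t *m x)).
rewrite [dot u (Rm t *m w)]dot_mulmxr symR// (dotC (Rm t *m u)).
by ring.
Qed.

Lemma ell_square t x u : t \in `[0, T] ->
  let v := freeu t x u in let r := invmx (Rm t) *m (H t *m x) in
  ell t x u x u = dot x (Q t *m x) - dot r (Rm t *m r) + dot v (Rm t *m v).
Proof.
move=> tT v r; have Rr : Rm t *m r = H t *m x by rewrite /r mulKVmx// Rm_unit.
rewrite /ell /v /freeu -/r mulmxDr Rr !(dotDl, dotDr).
have -> : dot r (Rm t *m u) = dot u (H t *m x).
  by rewrite dot_mulmxr symR// Rr dotC.
by ring.
Qed.

Lemma ell_ge t x u : t \in `[0, T] ->
  gq * vnorm x ^+ 2 + gr * vnorm (freeu t x u) ^+ 2 <= ell t x u x u.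
Proof.
move=> tT; rewrite ell_square// !sqr_vnorm.
have := coeR tT (freeu t x u); rewrite qform_scalar qformE.
have := coeQ tT x; rewrite qform_scalar qformE mulmxBl dotDr dotNr.
rewrite -!mulmxA [dot x ((H t)^T *m _)]dot_mulmxr trmxK.
set r := invmx _ *m _.
have -> : dot r (Rm t *m r) = dot (H t *m x) r.
  by rewrite dotC /r mulKVmx// Rm_unit.
by lra.
Qed.

Lemma ell_le t x u : t \in `[0, T] ->
  ell t x u x u <= lq * vnorm x ^+ 2 + lr * vnorm (freeu t x u) ^+ 2.
Proof.
move=> tT; rewrite ell_square//.
set r := invmx _ *m _; set v := freeu _ _ _.
have h1 : 0 <= dot r (Rm t *m r).
  by have := coeR tT r; rewrite qform_scalar qformE; apply: le_trans; rewrite mulr_ge0 ?dot_ge0// ltW.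
have h2 : dot x (Q t *m x) <= lq * vnorm x ^+ 2.
  rewrite (le_trans (dot_le_vnorm _ _))// expr2 mulrCA ler_wpM2l ?vnorm_ge0//.
  exact: bndQ.
have h3 : dot v (Rm t *m v) <= lr * vnorm v ^+ 2.
  rewrite (le_trans (dot_le_vnorm _ _))// expr2 mulrCA ler_wpM2l ?vnorm_ge0//.
  exact: bndR.
by lra.
Qed.

Lemma ell_ge0 t x u : t \in `[0, T] -> 0 <= ell t x u x u.
Proof.
move=> tT; apply: le_trans (ell_ge x u tT).
by rewrite addr_ge0// mulr_ge0 ?sqr_ge0// ltW.
Qed.

Lemma ellB t x u y w : t \in `[0, T] ->
  ell t (x - y) (u - w) (x - y) (u - w) =
  ell t x u x u - 2 * ell t x u y w + ell t y w y w.
Proof.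
move=> tT; have := ell_sym x u y w tT.
rewrite /ell !mulmxBr !(dotDl, dotDr, dotNl, dotNr).
by lra.
Qed.

(** Here (y, w) is any controlled trajectory, not necessarily an extremal one: the terms in A cancel
    and stationarity eliminates B^T l. Taking y = x gives the decay of the value, y another extremal
    the Wronskian, and y a test trajectory the cost comparison. *)
Lemma derive_pairing x u l y w t : ham x u l -> t \in `[0, T] ->
  mder y t (A t *m y t + B t *m w t) ->
  is_derive t 1 (fun s => dot (l s) (y s)) (- ell t (x t) (u t) (y t) (w t)).
Proof.
move=> hx tT dy; have [_ dl st] := hx t tT.
apply: (is_derive_cast (derive_dot dl dy)).
rewrite !(dotDl, dotDr, dotNl, dotNr) /ell.
rewrite [dot (_^T *m l t) _]dot_mulmxl trmxK.
rewrite [dot (l t) (B t *m _)]dot_mulmxr.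
have -> : (B t)^T *m l t = - (Rm t *m u t) - H t *m x t.
  by rewrite st opprK addrAC subrr add0r.
rewrite [dot (_^T *m u t) _]dot_mulmxl trmxK !(dotDl, dotNl).
rewrite [dot (Q t *m x t) _]dot_mulmxl symQ// [dot (Rm t *m u t) _]dot_mulmxl symR//.
by rewrite (dotC (w t)); ring.
Qed.

Lemma value_nonincreasing x u l s t : ham x u l -> 0 <= s -> s <= t -> t <= T ->
  dot (l t) (x t) <= dot (l s) (x s).
Proof.
move=> hx s0 st tT.
apply: (@le_of_derive_le0 _ (fun r => dot (l r) (x r))
  (fun r => - ell r (x r) (u r) (x r) (u r))) => // r /(itv_sub s0 tT) rT.
  by apply: derive_pairing => //; have [] := hx r rT.
by rewrite oppr_le0 ell_ge0.
Qed.

Lemma value_final (x l : R -> 'cV[R]_nx) : l T = QT *m x T ->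
  gq * vnorm (x T) ^+ 2 <= dot (l T) (x T).
Proof.
move=> ->; have := QT_ge (x T).
by rewrite qform_scalar qformE sqr_vnorm dotC.
Qed.

(** The two pairings have derivatives - [ell] with arguments exchanged, and [ell] is symmetric. *)
Lemma wronskian x u l y w k t : ham x u l -> ham y w k -> t \in `[0, T] ->
  dot (x t) (k t) - dot (l t) (y t) = dot (x T) (k T) - dot (l T) (y T).
Proof.
move=> hx hy tT.
have tT' : t <= T by move: tT; rewrite in_itv/= => /andP[].
have t0 : 0 <= t by move: tT; rewrite in_itv/= => /andP[].
have d (s : R) : s \in `[t, T] ->
    is_derive s 1 (fun s => dot (k s) (x s) - dot (l s) (y s)) 0.
  move=> /(itv_sub t0 (lexx T)) sT.
  have [dx _ _] := hx s sT; have [dy _ _] := hy s sT.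
  apply: (is_derive_cast (is_deriveB (derive_pairing hy sT dx) (derive_pairing hx sT dy))).
  by rewrite ell_sym// subrr.
rewrite ![dot (x _) _]dotC; apply/eqP; rewrite eq_le; apply/andP; split.
  by apply: (@ge_of_derive_ge0 _ (fun s => dot (k s) (x s) - dot (l s) (y s)) (fun=> 0)).
by apply: (@le_of_derive_le0 _ (fun s => dot (k s) (x s) - dot (l s) (y s)) (fun=> 0)).
Qed.

Lemma value_ge0 x u l t : ham x u l -> l T = QT *m x T -> t \in `[0, T] ->
  0 <= dot (l t) (x t).
Proof.
move=> hx lT; rewrite in_itv/= => /andP[t0 tT].
rewrite (le_trans _ (value_nonincreasing hx t0 tT (lexx T)))//.
by rewrite (le_trans _ (value_final lT))// mulr_ge0 ?sqr_ge0// ltW.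
Qed.

(* D(s) = value(s) - c0 (1 - (s-t)/sigma) |x(s)|^2 is nonincreasing and
   nonnegative at min(t + sigma, T). *)
Lemma value_ge sg c0 x u l t : 0 < sg -> 0 < c0 -> c0 <= gq ->
  c0 ^+ 2 * lb ^+ 2 <= gr * (gq - c0 * (sg^-1 + 2 * kappa)) ->
  ham x u l -> l T = QT *m x T -> t \in `[0, T] ->
  c0 * vnorm (x t) ^+ 2 <= dot (l t) (x t).
Proof.
move=> sg0 c00 c0q hc hx lT tT.
have tT' : t <= T by move: tT; rewrite in_itv/= => /andP[].
have t0 : 0 <= t by move: tT; rewrite in_itv/= => /andP[].
pose e := Num.min (t + sg) T.
have te : t <= e by rewrite le_min tT' andbT lerDl ltW.
have eT : e <= T by rewrite ge_min lexx orbT.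
have es : e <= t + sg by rewrite ge_min lexx.
pose phi s := 1 - (s - t) / sg.
pose D s := dot (l s) (x s) - c0 * (phi s * dot (x s) (x s)).
pose D' s := - ell s (x s) (u s) (x s) (u s)
  - c0 * (- sg^-1 * dot (x s) (x s)
          + phi s * (2 * dot (x s) (A s *m x s + B s *m u s))).
have dD s : s \in `[t, e] -> is_derive s 1 D (D' s).
  move=> /(itv_sub t0 eT) sT; have [dx _ _] := hx s sT.
  have d1 := derive_pairing hx sT dx; have d2 := derive_dot dx dx.
  have d3 : is_derive s 1 phi (- sg^-1).
    by apply: is_derive_eq; rewrite /GRing.scale/=; ring.
  apply: (is_derive_cast (is_deriveB d1 (is_deriveZ c0 (is_deriveM d3 d2)))).
  by rewrite /D' /GRing.scale/= (dotC _ (x s)); ring.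
have phi01 s : s \in `[t, e] -> 0 <= phi s <= 1.
  rewrite in_itv/= => /andP[ts se]; rewrite /phi subr_ge0 lerBlDr lerDl.
  by rewrite ler_pdivrMr// mul1r lerBlDl (le_trans se)//= divr_ge0 ?subr_ge0// ltW.
have D'0 s : s \in `[t, e] -> D' s <= 0.
  move=> ste; have sT := itv_sub t0 eT ste; have /andP[p0 p1] := phi01 s ste.
  have hl := ell_ge (x s) (u s) sT.
  rewrite /D' -sqr_vnorm; set v := freeu s (x s) (u s) in hl *.
  set X := vnorm (x s) in hl *; set V := vnorm v in hl *.
  have X0 : 0 <= X by exact: vnorm_ge0.
  have V0 : 0 <= V by exact: vnorm_ge0.
  have uE : u s = v - invmx (Rm s) *m (H s *m x s) by rewrite /v /freeu addrK.
  (* Substituting u = v - R^-1 H x bounds how fast |x| can shrink; the feedback part adds lb lh / gr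
     to la, which is the origin of [kappa]. *)
  have growth : - dot (x s) (A s *m x s + B s *m u s) <= kappa * X ^+ 2 + lb * X * V.
    rewrite -dotNr (le_trans (dot_le_vnorm _ _))// -/X vnormN.
    have h : vnorm (A s *m x s + B s *m u s) <= kappa * X + lb * V.
      rewrite (le_trans (ler_vnormD _ _))//.
      have h1 : vnorm (A s *m x s) <= la * X by exact: bndA.
      have h2 : vnorm (u s) <= V + lh * X / gr.
        rewrite uE (le_trans (ler_vnormD _ _))// vnormN lerD2l.
        by rewrite (le_trans (bnd_invR _ sT))// ler_pM2r ?invr_gt0// bndH.
      have h3 : vnorm (B s *m u s) <= lb * (V + lh * X / gr).
        by rewrite (le_trans (bndB sT _))// ler_pM2l.
      by rewrite (le_trans (lerD h1 h3))// le_eqVlt; apply/orP; left; apply/eqP; ring.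
    by rewrite (le_trans (ler_wpM2l X0 h))// le_eqVlt; apply/orP; left; apply/eqP; ring.
  set g := dot (x s) _ in growth *.
  have k0 : 0 < kappa by rewrite addr_gt0// divr_gt0// mulr_gt0.
  have hp : - (phi s * (2 * g)) <= 2 * kappa * X ^+ 2 + 2 * lb * X * V.
    have : phi s * (2 * - g) <= phi s * (2 * (kappa * X ^+ 2 + lb * X * V)).
      by rewrite ler_wpM2l// ler_pM2l.
    have : phi s * (2 * (kappa * X ^+ 2 + lb * X * V)) <= 1 * (2 * (kappa * X ^+ 2 + lb * X * V)).
      by rewrite ler_wpM2r// mulr_ge0// addr_ge0 ?mulr_ge0 ?sqr_ge0// ltW.
    by lra.
  have := ler_wpM2l (ltW c00) hp.
  (* The hypothesis [hc] is the discriminant condition for this quadratic form in (X, V). *)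
  have amgm : 2 * (c0 * lb) * X * V <= (gq - c0 * (sg^-1 + 2 * kappa)) * X ^+ 2 + gr * V ^+ 2.
    rewrite -(ler_pM2l gr0).
    have s1 : 0 <= (c0 * lb * X - gr * V) ^+ 2 by exact: sqr_ge0.
    have s2 := ler_wpM2r (sqr_ge0 X) hc.
    by lra.
  by lra.
(* Either the cut-off weight has reached 0 at t + sg, or e = T and the terminal weight QT >= gq >=
   c0 absorbs the subtracted term. *)
have De : 0 <= D e.
  rewrite /D -sqr_vnorm; have [he|he] := leP (t + sg) T.
    have eE : e = t + sg by apply/min_idPl.
    have -> : phi e = 0 by rewrite /phi eE addrAC subrr add0r divff ?subrr ?gt_eqF.
    rewrite mul0r mulr0 subr0 (value_ge0 hx lT)//.
    by rewrite in_itv/= eT andbT (le_trans t0).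
  have eE : e = T by apply/min_idPr/ltW.
  rewrite eE; have := value_final lT.
  have /andP[p0 p1] : 0 <= phi T <= 1 by apply: phi01; rewrite -eE in_itv/= te lexx.
  set X := vnorm (x T) ^+ 2; have X0 : 0 <= X by exact: sqr_ge0.
  have h1 : phi T * X <= X by rewrite -[leRHS]mul1r ler_wpM2r.
  have := ler_wpM2l (ltW c00) h1; have := ler_wpM2r X0 c0q.
  by lra.
have := le_of_derive_le0 te dD D'0.
rewrite [X in _ <= X -> _]/D /phi subrr mul0r subr0 mul1r -sqr_vnorm.
by lra.
Qed.

(** Integrated form of 0 <= [ell] at (x - z, u - w), which by [ellB] is a convexity inequality. J
    plays the role of a bound on the cost still to be paid by (z, w) up to time e and beyond. *)
Lemma value_compare x u l z w (J J' : R -> R) t e : ham x u l ->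
  0 <= t -> t <= e -> e <= T ->
  (forall s : R, s \in `[t, e] -> mder z s (A s *m z s + B s *m w s)) ->
  (forall s : R, s \in `[t, e] -> is_derive s 1 J (J' s)) ->
  (forall s : R, s \in `[t, e] -> ell s (z s) (w s) (z s) (w s) <= - J' s) ->
  2 * dot (l e) (z e) <= dot (l e) (x e) + J e ->
  2 * dot (l t) (z t) <= dot (l t) (x t) + J t.
Proof.
move=> hx t0 te eT dz dJ hJ fin.
suff : dot (l e) (x e) - 2 * dot (l e) (z e) + J e <=
       dot (l t) (x t) - 2 * dot (l t) (z t) + J t by lra.
apply: (@le_of_derive_le0 _ (fun s => dot (l s) (x s) - 2 * dot (l s) (z s) + J s)
  (fun s => - ell s (x s) (u s) (x s) (u s)
            - 2 * - ell s (x s) (u s) (z s) (w s) + J' s)) => // s ste.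
  have sT := itv_sub t0 eT ste; have [dx _ _] := hx s sT.
  have d1 := derive_pairing hx sT dx; have d2 := derive_pairing hx sT (dz s ste).
  exact: is_deriveD (is_deriveB d1 (is_deriveZ 2 d2)) (dJ s ste).
have sT := itv_sub t0 eT ste.
have := ell_ge0 (x s - z s) (u s - w s) sT; rewrite ellB//.
by have := hJ s ste; lra.
Qed.

(** The functions exp(-2 la r) |x|^2 and exp(2 la r) |x|^2 are monotone in opposite directions. The
    second estimate is what bounds the inverse flow. *)
Lemma flow_growth (x : R -> 'cV[R]_nx) s t : 0 <= s -> s <= t -> t <= T ->
  (forall r : R, r \in `[0, T] -> mder x r (A r *m x r)) ->
  vnorm (x t) <= expR (la * (t - s)) * vnorm (x s) /\
  vnorm (x s) <= expR (la * (t - s)) * vnorm (x t).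
Proof.
move=> s0 st tT dx.
have bnd r : r \in `[s, t] -> `|2 * dot (x r) (A r *m x r)| <= 2 * la * dot (x r) (x r).
  move=> /(itv_sub s0 tT) rT; rewrite -sqr_vnorm.
  have h v : vnorm v <= la * vnorm (x r) -> 2 * dot (x r) v <= 2 * la * vnorm (x r) ^+ 2.
    move=> hv; have := dot_le_vnorm (x r) v; have := ler_wpM2l (vnorm_ge0 (x r)) hv.
    by lra.
  rewrite ler_norml h ?bndA// andbT.
  by have := h (- (A r *m x r)); rewrite vnormN dotNr => /(_ (bndA rT _)); lra.
have d c r : r \in `[s, t] -> is_derive r 1
    (fun r => 1 * expR (c * r + - (c * s)) * dot (x r) (x r))
    (expR (c * r + - (c * s)) * (c * dot (x r) (x r) + 2 * dot (x r) (A r *m x r))).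
  move=> /(itv_sub s0 tT) rT; have dxr := dx r rT.
  apply: (is_derive_cast (is_deriveM (is_derive_expR_affine c (- (c * s)) 1 r) (derive_dot dxr dxr))).
  by rewrite /GRing.scale/= (dotC (A r *m x r)); ring.
have e0 c : expR (c * s + - (c * s)) = 1 by rewrite subrr expR0.
split; apply: vnorm_le; rewrite ?mulr_ge0 ?expR_ge0 ?vnorm_ge0// exprMn sqr_vnorm expr2 -expRD.
  have := le_of_derive_le0 st (d (- (2 * la))).
  rewrite e0 !mul1r => h.
  have {h} : expR (- (2 * la) * t + - (- (2 * la) * s)) * dot (x t) (x t) <= dot (x s) (x s).
    apply: h => r rst; rewrite pmulr_rle0 ?expR_gt0//.
    by have := bnd r rst; rewrite ler_norml => /andP[_ ?]; lra.
  rewrite -(ler_pM2l (expR_gt0 (la * (t - s) + la * (t - s)))) mulrA -expRD.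
  by rewrite [X in expR X * _ <= _](_ : _ = 0) ?expR0 ?mul1r//; ring.
have := ge_of_derive_ge0 st (d (2 * la)).
rewrite e0 !mul1r => h.
have {h} : dot (x s) (x s) <= expR (2 * la * t + - (2 * la * s)) * dot (x t) (x t).
  apply: h => r rst; rewrite mulr_ge0 ?expR_ge0//.
  by have := bnd r rst; rewrite ler_norml => /andP[? _]; lra.
by rewrite (_ : 2 * la * t + - (2 * la * s) = la * (t - s) + la * (t - s)); last by ring.
Qed.

(** * Trajectories steered to the origin by the controllability Gramian *)

Section Steering.
Variables (t0 t1 : R) (Psi Th W : R -> 'M[R]_nx).
Hypotheses (t00 : 0 <= t0) (t01 : t0 <= t1) (t1T : t1 <= T).
Hypothesis dPsi : forall t : R, t \in `[0, T] -> mder Psi t (A t *m Psi t).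
Hypothesis Psi0 : Psi t0 = 1%:M.
Hypothesis PsiTh : forall t : R, t \in `[0, T] -> Psi t *m Th t = 1%:M.
Hypothesis dW : forall t : R, t \in `[0, T] ->
  mder W t (Th t *m B t *m (B t)^T *m (Th t)^T).
Hypothesis W0 : W t0 = 0.

(** The minimum-energy control. Here Psi is the flow of A from t0, Th its inverse and W(t) the
    Gramian of [t0, t]. Under this control, Psi(s) (xi - W(s) q) starts at xi, and it vanishes at t1
    when W(t1) q = xi. *)
Let steer (q : 'cV[R]_nx) (t : R) := - ((B t)^T *m ((Th t)^T *m q)).

Lemma flow_vnorm v s : s \in `[t0, t1] ->
  vnorm (Psi s *m v) <= expR (la * (s - t0)) * vnorm v.
Proof.
rewrite in_itv/= => /andP[ts st].
have [] := @flow_growth (fun r => Psi r *m v) t0 s t00 ts (le_trans st t1T).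
  by move=> r rT; rewrite mulmxA; exact/mderMr/dPsi.
by rewrite Psi0 mul1mx.
Qed.

Lemma steer_vnorm q s : s \in `[t0, t1] ->
  vnorm (steer q s) <= lb * (expR (la * (s - t0)) * vnorm q).
Proof.
move=> sst; have sT := itv_sub t00 t1T sst.
move: (sst); rewrite in_itv/= => /andP[ts st].
have hTh v : vnorm (Th s *m v) <= expR (la * (s - t0)) * vnorm v.
  have [] := @flow_growth (fun r => Psi r *m (Th s *m v)) t0 s t00 ts (le_trans st t1T).
    by move=> r rT; rewrite mulmxA; exact/mderMr/dPsi.
  by rewrite Psi0 mul1mx mulmxA PsiTh// mul1mx.
rewrite vnormN (le_trans (vnorm_trmx_mulmx_le (ltW lb0) (bndB sT) _))//.
rewrite ler_pM2l//; apply: vnorm_trmx_mulmx_le hTh _; exact: expR_ge0.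
Qed.

(** Thus q.(W(s) q) is the energy spent by the control up to time s. *)
Lemma derive_steer_form q s : s \in `[t0, t1] ->
  is_derive s 1 (fun r => dot q (W r *m q)) (vnorm (steer q s) ^+ 2).
Proof.
move=> /(itv_sub t00 t1T) sT; rewrite vnormN sqr_vnorm.
apply: (is_derive_cast (derive_dot (mder_cst q s) (mderMr q (dW sT)))).
rewrite dot0l add0r -!mulmxA.
by rewrite dot_mulmxr dot_mulmxr.
Qed.

Lemma steer_gramian_sym s : s \in `[t0, t1] -> (W s)^T = W s.
Proof.
rewrite in_itv/= => /andP[ts st]; apply/eqP; rewrite -subr_eq0; apply/eqP.
have d (r : R) : r \in `[t0, s] -> mder (fun r => (W r)^T - W r) r 0.
  move=> /(itv_sub t00 (le_trans st t1T)) rT.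
  apply: mder_eq (mderB (mder_tr (dW rT)) (dW rT)) _.
  by rewrite !trmx_mul !trmxK !mulmxA subrr.
by rewrite -(mder0_cst ts d) W0 trmx0 subrr.
Qed.

Lemma steer_gramian_form q s : s \in `[t0, t1] ->
  [/\ 0 <= dot q (W s *m q), dot q (W s *m q) <= dot q (W t1 *m q) &
      dot q (W s *m q) <= lb ^+ 2 * expint la (s - t0) * dot q q].
Proof.
rewrite in_itv/= => /andP[ts st].
have sub1 r : r \in `[t0, s] -> r \in `[t0, t1].
  by rewrite !in_itv/= => /andP[-> /le_trans ->].
have sub2 r : r \in `[s, t1] -> r \in `[t0, t1].
  by rewrite !in_itv/= => /andP[/(le_trans ts) -> ->].
split.
- have := @ge_of_derive_ge0 _ _ _ t0 s ts (fun r h => derive_steer_form q (sub1 r h)).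
  by rewrite W0 mul0mx dot0r; apply => r _; rewrite sqr_ge0.
- have := @ge_of_derive_ge0 _ _ _ s t1 st (fun r h => derive_steer_form q (sub2 r h)).
  by apply => r _; rewrite sqr_ge0.
have d r : r \in `[t0, s] -> is_derive r 1
    (fun r => dot q (W r *m q) - lb ^+ 2 * vnorm q ^+ 2 / (2 * la) * expR (2 * la * r + - (2 * la * t0)))
    (vnorm (steer q r) ^+ 2 - lb ^+ 2 * vnorm q ^+ 2 * expR (2 * la * (r - t0))).
  move=> rs; apply: (is_derive_cast (is_deriveB (derive_steer_form q (sub1 r rs)) (is_derive_expR_affine _ _ _ _))).
  rewrite -mulrBr; congr (_ - _); field.
  by rewrite gt_eqF.
have := le_of_derive_le0 ts d.
rewrite W0 mul0mx dot0r subrr expR0 mulr1 /expint -sqr_vnorm -mulrBr => h.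
have {h} := h _.
have -> : lb ^+ 2 * ((expR (2 * la * (s - t0)) - 1) / (2 * la)) * vnorm q ^+ 2
   = lb ^+ 2 * vnorm q ^+ 2 / (2 * la) * (expR (2 * la * (s - t0)) - 1) by field; rewrite gt_eqF.
move=> h; suff : dot q (W s *m q) - lb ^+ 2 * vnorm q ^+ 2 / (2 * la) * expR (2 * la * (s - t0)) <= 0 - lb ^+ 2 * vnorm q ^+ 2 / (2 * la) by lra.
apply: h => r /sub1 rt; have := steer_vnorm q rt.
rewrite -ler_sqr ?nnegrE ?mulr_ge0 ?vnorm_ge0 ?expR_ge0 ?(ltW lb0)//.
rewrite !exprMn [expR _ ^+ 2]expr2 -expRD.
have -> : la * (r - t0) + la * (r - t0) = 2 * la * (r - t0) by ring.
by lra.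
Qed.

Lemma steer_gramian_vnorm q a s : 0 < a -> s \in `[t0, t1] ->
  (forall v, dot v (W s *m v) <= a * dot v v) -> vnorm (W s *m q) <= a * vnorm q.
Proof.
move=> a0 sst h; apply: vnorm_psd_mulmx_le => // [|v|v].
- exact: steer_gramian_sym.
- rewrite !qformE mul0mx dot0r.
  by have [] := steer_gramian_form v sst.
- by rewrite qform_scalar qformE.
Qed.

(** The cost of steering xi to 0 bounds the right-hand side: the squared state is integrated as an
    exponential, and the control energy is q.(W(t1) q) = q.xi <= |xi|^2 / a0. *)
Lemma value_le_steered a0 a1 sg xi x u l : 0 < a0 -> 0 < a1 -> 0 < sg -> t1 <= t0 + sg ->
  loewner_le a0%:M (W t1) -> loewner_le (W t1) a1%:M -> ham x u l ->
  l T = QT *m x T ->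
  2 * dot (l t0) xi <= dot (l t0) (x t0) +
   (lq * (1 + lb ^+ 2 * expint la sg / a0) ^+ 2 * expint la sg
    + lr * (2 / a0 + 2 * (lh / gr) ^+ 2 * (1 + a1 / a0) ^+ 2 * expint la sg)) * vnorm xi ^+ 2.
Proof.
move=> a00 a10 sg0 t1s Wge Wle hx lT; set F := expint la sg.
have la2 : 2 * la != 0 by rewrite gt_eqF// mulr_gt0.
have F0 : 0 < F by rewrite /F /expint divr_gt0 ?mulr_gt0// subr_gt0 -expR0 ltr_expR !mulr_gt0.
pose q := invmx (W t1) *m xi.
have Wq : W t1 *m q = xi by rewrite mulKVmx// (coercive_unitmx a00).
have qle : vnorm q <= vnorm xi / a0 by exact: coercive_invmx_le.
set Xi := vnorm xi in qle *.
have Xi0 : 0 <= Xi by exact: vnorm_ge0.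
pose z s := Psi s *m (xi - W s *m q).
have t0in : t0 \in `[t0, t1] by rewrite in_itv/= lexx.
have t1in : t1 \in `[t0, t1] by rewrite in_itv/= lexx andbT.
have dz s : s \in `[t0, t1] -> mder z s (A s *m z s + B s *m steer q s).
  move=> /(itv_sub t00 t1T) sT.
  apply: mder_eq (mderM (dPsi sT) (mderB (mder_cst xi s) (mderMr q (dW sT)))) _.
  rewrite sub0r /z mulmxA; congr (_ + _).
  by rewrite /steer !mulmxN !mulmxA PsiTh// mul1mx.
have zle s a : s \in `[t0, t1] -> 0 < a ->
    (forall v, dot v (W s *m v) <= a * dot v v) ->
    vnorm (z s) ^+ 2 <= expR (2 * la * s + - (2 * la * t0)) * (1 + a / a0) ^+ 2 * Xi ^+ 2.
  move=> sst a_gt0 ha.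
  have h1 : vnorm (xi - W s *m q) <= (1 + a / a0) * Xi.
    rewrite (le_trans (ler_vnormD _ _))// vnormN mulrDl mul1r lerD2l.
    rewrite (le_trans (steer_gramian_vnorm q a_gt0 sst ha))// mulrAC -mulrA.
    by rewrite ler_pM2l.
  have : vnorm (z s) <= expR (la * (s - t0)) * ((1 + a / a0) * Xi).
    rewrite (le_trans (flow_vnorm _ sst))// ler_pM2l ?expR_gt0//.
  have r0 : 0 <= (1 + a / a0) * Xi by rewrite mulr_ge0// addr_ge0// divr_ge0// ltW.
  rewrite -ler_sqr ?nnegrE ?(mulr_ge0 (expR_ge0 _) r0) ?vnorm_ge0//.
  rewrite !exprMn [expR _ ^+ 2]expr2 -expRD mulrA.
  by rewrite (_ : la * (s - t0) + la * (s - t0) = 2 * la * s + - (2 * la * t0)); last by ring.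
pose a' := lb ^+ 2 * F.
have a'0 : 0 < a' by rewrite mulr_gt0// exprn_gt0.
(* Two bounds on W(s) are kept, the assumed one and the one computed from la and lb: the first
   enters the penalty on the free control, the second the penalty on the state, matching [alpha0']
   and [alpha1']. *)
have form1 (s : R) (v : 'cV[R]_nx) : s \in `[t0, t1] -> dot v (W s *m v) <= a1 * dot v v.
  move=> sst; have [_ h _] := steer_gramian_form v sst.
  by have := Wle v; rewrite qform_scalar qformE; apply: le_trans.
have form2 (s : R) (v : 'cV[R]_nx) : s \in `[t0, t1] -> dot v (W s *m v) <= a' * dot v v.
  move=> sst; have [_ _ h] := steer_gramian_form v sst.
  rewrite (le_trans h)// ler_wpM2r ?dot_ge0// ler_wpM2l ?sqr_ge0//.
  rewrite /F /expint ler_pM2r ?invr_gt0 ?mulr_gt0// lerD2r ler_expR ler_pM2l ?mulr_gt0//.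
  by rewrite lerBlDl (le_trans _ t1s)//; move: sst; rewrite in_itv/= => /andP[].
pose P := (lq * (1 + a' / a0) ^+ 2 + lr * (2 * (lh / gr) ^+ 2 * (1 + a1 / a0) ^+ 2)) * Xi ^+ 2.
have P0 : 0 <= P.
  apply: (mulr_ge0 _ (sqr_ge0 _)); apply: addr_ge0.
    exact: (mulr_ge0 (ltW lq0) (sqr_ge0 _)).
  apply: (mulr_ge0 (ltW lr0)); apply: (mulr_ge0 _ (sqr_ge0 _)).
  exact: (mulr_ge0 _ (sqr_ge0 _)).
(* First bracket: the integral of P exp(2 la (r - t0)) over r from s to t0 + sg, an overestimate
   because t1 <= t0 + sg. Second bracket: 2 lr times the control energy left between s and t1, since
   W(t1) q = xi. *)
pose J s := (P / (2 * la) * expR (2 * la * sg) -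
             P / (2 * la) * expR (2 * la * s + - (2 * la * t0)))
  + (2 * lr * dot q xi - 2 * lr * dot q (W s *m q)).
pose J' s := - (P * expR (2 * la * s + - (2 * la * t0))) - 2 * lr * vnorm (steer q s) ^+ 2.
have dJ s : s \in `[t0, t1] -> is_derive s 1 J (J' s).
  move=> sst.
  have d1 := is_deriveB (is_derive_cst (P / (2 * la) * expR (2 * la * sg)) s 1)
    (is_derive_expR_affine (2 * la) (- (2 * la * t0)) (P / (2 * la)) s).
  have d2 := is_deriveB (is_derive_cst (2 * lr * dot q xi) s 1)
    (is_deriveZ (2 * lr) (derive_steer_form q sst)).
  apply: (is_derive_cast (is_deriveD d1 d2)); rewrite /J' /GRing.scale/=.
  by field; rewrite gt_eqF.
have hJ s : s \in `[t0, t1] ->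
    ell s (z s) (steer q s) (z s) (steer q s) <= - J' s.
  move=> sst; have sT := itv_sub t00 t1T sst.
  rewrite (le_trans (ell_le _ _ sT))// /J' /P.
  set e := expR _; have e0 : 0 < e by exact: expR_gt0.
  have z1 := zle s a1 sst a10 (fun v => form1 s v sst).
  have z2 := zle s a' sst a'0 (fun v => form2 s v sst).
  set w := vnorm (steer q s); have w0 : 0 <= w by exact: vnorm_ge0.
  set y := vnorm (z s) in z1 z2 *; have y0 : 0 <= y by exact: vnorm_ge0.
  have h : vnorm (freeu s (z s) (steer q s)) <= w + lh / gr * y.
    rewrite /freeu (le_trans (ler_vnormD _ _))// lerD2l (le_trans (bnd_invR _ sT))//.
    by rewrite mulrAC ler_pM2r ?invr_gt0// bndH.
  (* Squaring the sum costs a factor 2 on each term, whence the numerator 2 of 2 / [alpha0] in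
     [alpha0']. *)
  have h2 : vnorm (freeu s (z s) (steer q s)) ^+ 2 <= 2 * w ^+ 2 + 2 * (lh / gr) ^+ 2 * y ^+ 2.
    have k0 : 0 <= lh / gr * y by rewrite mulr_ge0// divr_ge0// ltW.
    have : vnorm (freeu s (z s) (steer q s)) ^+ 2 <= (w + lh / gr * y) ^+ 2.
      by rewrite ler_sqr ?nnegrE ?vnorm_ge0 ?addr_ge0.
    move/le_trans; apply.
    have : 0 <= (w - lh / gr * y) ^+ 2 by exact: sqr_ge0.
    by lra.
  have := ler_wpM2l (ltW lr0) h2; have := ler_wpM2l (ltW lq0) z2.
  have k0 : 0 <= lr * (2 * (lh / gr) ^+ 2).
    by apply: (mulr_ge0 (ltW lr0)); exact: (mulr_ge0 _ (sqr_ge0 _)).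
  have := ler_wpM2l k0 z1.
  by rewrite -/e; lra.
have zT : z t1 = 0 by rewrite /z Wq subrr mulmx0.
have fin : 2 * dot (l t1) (z t1) <= dot (l t1) (x t1) + J t1.
  rewrite zT dot0r mulr0 addr_ge0//.
  - by apply: (value_ge0 hx lT); exact: itv_sub t1in.
  - rewrite /J Wq subrr addr0 subr_ge0 ler_wpM2l//.
      by rewrite divr_ge0// mulr_ge0// ltW.
    rewrite ler_expR -mulrBr ler_pM2l ?mulr_gt0//; by rewrite lerBlDl.
have := value_compare hx t00 t01 t1T dz dJ hJ fin.
rewrite /z W0 mul0mx subr0 Psi0 mul1mx => /le_trans; apply; rewrite lerD2l.
rewrite /J W0 mul0mx dot0r mulr0 subr0 subrr expR0.
have qxi : dot q xi <= Xi ^+ 2 / a0.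
  by rewrite (le_trans (dot_le_vnorm _ _))// expr2 mulrAC ler_wpM2r.
have := ler_wpM2l (ltW lr0) qxi.
suff -> : P / (2 * la) * expR (2 * la * sg) - P / (2 * la) * 1 = P * F.
  by rewrite /P -/a'; lra.
by rewrite /F /expint; field; rewrite gt_eqF.
Qed.

End Steering.

(** Within sg of T a steering interval need not fit, but the remaining time is so short that doing
    nothing is affordable: the running cost contributes the term in [expint], the terminal cost the
    exponential. *)
Lemma value_le_free x u l z t0 sg : ham x u l -> l T = QT *m x T ->
  0 <= t0 -> t0 <= T -> T <= t0 + sg ->
  (forall t : R, t \in `[0, T] -> mder z t (A t *m z t)) ->
  2 * dot (l t0) (z t0) <= dot (l t0) (x t0) +
    lq * (expint la sg + expR (2 * la * sg)) * vnorm (z t0) ^+ 2.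
Proof.
move=> hx lT t00 t0T Ts dz; set Z := vnorm (z t0).
have la2 : 0 < 2 * la by rewrite mulr_gt0.
pose P := lq * Z ^+ 2; have P0 : 0 <= P by exact: (mulr_ge0 (ltW lq0) (sqr_ge0 _)).
have zle s : s \in `[t0, T] -> vnorm (z s) ^+ 2 <= expR (2 * la * s + - (2 * la * t0)) * Z ^+ 2.
  rewrite in_itv/= => /andP[ts sT]; have [h _] := flow_growth t00 ts sT dz.
  have : vnorm (z s) ^+ 2 <= (expR (la * (s - t0)) * Z) ^+ 2.
    by rewrite ler_sqr ?nnegrE ?mulr_ge0 ?vnorm_ge0 ?expR_ge0.
  rewrite exprMn [expR _ ^+ 2]expr2 -expRD.
  by rewrite (_ : la * (s - t0) + la * (s - t0) = 2 * la * s + - (2 * la * t0)); last by ring.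
pose J s := (P / (2 * la) * expR (2 * la * sg) -
             P / (2 * la) * expR (2 * la * s + - (2 * la * t0))) + P * expR (2 * la * sg).
pose J' s := - (P * expR (2 * la * s + - (2 * la * t0))).
have dJ s : s \in `[t0, T] -> is_derive s 1 J (J' s).
  move=> _.
  have d1 := is_deriveB (is_derive_cst (P / (2 * la) * expR (2 * la * sg)) s 1)
    (is_derive_expR_affine (2 * la) (- (2 * la * t0)) (P / (2 * la)) s).
  apply: (is_derive_cast (is_deriveD d1 (is_derive_cst (P * expR (2 * la * sg)) s 1))).
  by rewrite /J'; field; rewrite gt_eqF.
have hJ s : s \in `[t0, T] -> ell s (z s) 0 (z s) 0 <= - J' s.
  move=> st; have sT := itv_sub t00 (lexx T) st.
  rewrite /ell !dot0l !addr0 /J' opprK /P mulrAC -mulrA.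
  rewrite (le_trans _ (ler_wpM2l (ltW lq0) (zle s st)))//.
  rewrite (le_trans (dot_le_vnorm _ _))// expr2 mulrCA ler_wpM2l ?vnorm_ge0//.
  exact: bndQ.
have eT : expR (2 * la * T + - (2 * la * t0)) <= expR (2 * la * sg).
  by rewrite ler_expR -mulrBr ler_pM2l// lerBlDl.
have fin : 2 * dot (l T) (z T) <= dot (l T) (x T) + J T.
  have zT := zle T; have {zT} := zT _; rewrite in_itv/= t0T lexx => /(_ isT) zT.
  have J1 : lq * vnorm (z T) ^+ 2 <= J T.
    have h1 := ler_wpM2l (ltW lq0) zT; have h2 := ler_wpM2l P0 eT.
    have : 0 <= P / (2 * la) * expR (2 * la * sg) - P / (2 * la) * expR (2 * la * T + - (2 * la * t0)).
      by rewrite subr_ge0 ler_wpM2l// divr_ge0// ltW.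
    by move: h1 h2; rewrite /J /P; lra.
  have h3 := QT_le (z T); rewrite qform_scalar qformE -sqr_vnorm in h3.
  have := QT_ge (x T - z T); rewrite qform_scalar qformE lT => h4.
  (* The terminal counterpart of the convexity inequality: it compares the terminal costs of x and
     z. *)
  have h5 : 0 <= dot (x T - z T) (QT *m (x T - z T)).
    by rewrite (le_trans _ h4)// mulr_ge0 ?dot_ge0// ltW.
  move: h5; rewrite mulmxBr !(dotDl, dotDr, dotNl, dotNr).
  have -> : dot (QT *m x T) (z T) = dot (x T) (QT *m z T) by rewrite dot_mulmxl symQT.
  have -> : dot (z T) (QT *m x T) = dot (x T) (QT *m z T) by rewrite dotC dot_mulmxl symQT.
  by rewrite (dotC (QT *m x T)); lra.
have := @value_compare x u l z (fun=> 0) J J' t0 T hx t00 t0T (lexx T) _ dJ hJ fin.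
move=> h; apply: (le_trans (h _)).
  by move=> s /(itv_sub t00 (lexx T)) sT; rewrite mulmx0 addr0; exact: dz.
rewrite lerD2l /J /P /expint subrr expR0 le_eqVlt; apply/orP; left; apply/eqP.
by field; rewrite gt_eqF.
Qed.

(** * Decay of the closed loop and response to a terminal perturbation *)

Section ClosedLoop.
Variables c0 c1 : R.
Hypotheses (c00 : 0 < c0) (c10 : 0 < c1).
Hypothesis lower : forall x u l, ham x u l -> l T = QT *m x T ->
  forall t : R, t \in `[0, T] -> c0 * vnorm (x t) ^+ 2 <= dot (l t) (x t).
Hypothesis upper : forall x u l, ham x u l -> l T = QT *m x T ->
  forall t : R, t \in `[0, T] -> forall xi,
  2 * dot (l t) xi <= dot (l t) (x t) + c1 * vnorm xi ^+ 2.
Hypotheses (cA : ccont T A) (cB : ccont T B) (cQ : ccont T Q) (cH : ccont T H).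
Hypothesis cR : ccont T Rm.

Let rho := gq / (2 * c1).
Let cz := Num.sqrt (c1 / c0).

Let rho0 : 0 < rho.
Proof. by rewrite divr_gt0// mulr_gt0. Qed.

Let cz2 : cz ^+ 2 = c1 / c0.
Proof. by rewrite sqr_sqrtr// divr_ge0// ltW. Qed.

Lemma value_le x u l t : ham x u l -> l T = QT *m x T -> t \in `[0, T] ->
  dot (l t) (x t) <= c1 * vnorm (x t) ^+ 2.
Proof. by move=> hx lT tT; have := upper hx lT tT (x t); lra. Qed.

Lemma adjoint_le x u l t : ham x u l -> l T = QT *m x T -> t \in `[0, T] ->
  vnorm (l t) <= c1 * vnorm (x t).
Proof.
move=> hx lT tT; apply: vnorm_le_of_quadratic; rewrite ?vnorm_ge0// => y.
have := upper hx lT tT y; have := value_le hx lT tT.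
by rewrite -(sqr_vnorm y); lra.
Qed.

Lemma state_decay x u l s t : ham x u l -> l T = QT *m x T ->
  0 <= s -> s <= t -> t <= T ->
  vnorm (x t) <= cz * expR (- (rho * (t - s))) * vnorm (x s).
Proof.
move=> hx lT s0 st tT.
have sT : s \in `[0, T] by rewrite in_itv/= s0 (le_trans st).
have tTi : t \in `[0, T] by rewrite in_itv/= tT (le_trans s0).
have d r : r \in `[s, t] -> is_derive r 1
   (fun r => 1 * expR (2 * rho * r + - (2 * rho * s)) * dot (l r) (x r))
   (expR (2 * rho * r + - (2 * rho * s)) *
     (2 * rho * dot (l r) (x r) - ell r (x r) (u r) (x r) (u r))).
  move=> /(itv_sub s0 tT) rT; have [dx _ _] := hx r rT.
  apply: (is_derive_cast (is_deriveM (is_derive_expR_affine _ _ 1 r) (derive_pairing hx rT dx))).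
  by rewrite /GRing.scale/=; ring.
have := le_of_derive_le0 st d; rewrite subrr expR0 !mul1r => h.
have {h} hV : expR (2 * rho * t + - (2 * rho * s)) * dot (l t) (x t) <= dot (l s) (x s).
  apply: h => r /(itv_sub s0 tT) rT; rewrite pmulr_rle0 ?expR_gt0//.
  have h1 := ell_ge (x r) (u r) rT.
  have h2 : 2 * rho * dot (l r) (x r) <= gq * vnorm (x r) ^+ 2.
    have -> : gq * vnorm (x r) ^+ 2 = 2 * rho * (c1 * vnorm (x r) ^+ 2).
      by rewrite /rho; field; rewrite gt_eqF.
    by rewrite ler_wpM2l ?(value_le hx lT)// mulr_ge0// ltW.
  have h3 : 0 <= gr * vnorm (freeu r (x r) (u r)) ^+ 2 by exact: (mulr_ge0 (ltW gr0) (sqr_ge0 _)).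
  by lra.
apply: vnorm_le; first by rewrite mulr_ge0 ?vnorm_ge0// mulr_ge0 ?sqrtr_ge0 ?expR_ge0.
rewrite -sqr_vnorm !exprMn cz2.
set e := expR (- _).
have e2 : expR (2 * rho * t + - (2 * rho * s)) * e ^+ 2 = 1.
  by rewrite /e expr2 -!expRD [X in expR X](_ : _ = 0) ?expR0//; ring.
have h1 := ler_wpM2l (expR_ge0 (2 * rho * t + - (2 * rho * s))) (lower hx lT tTi).
have h2 := value_le hx lT sT.
have h3 := ler_wpM2r (sqr_ge0 e) (le_trans h1 (le_trans hV h2)).
have {h3} h4 : c0 * vnorm (x t) ^+ 2 <= c1 * vnorm (x s) ^+ 2 * e ^+ 2.
  apply: le_trans h3; rewrite mulrAC e2 mul1r//.
have -> : c1 / c0 * e ^+ 2 * vnorm (x s) ^+ 2 = (c1 * vnorm (x s) ^+ 2 * e ^+ 2) / c0.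
  by field; rewrite gt_eqF.
by rewrite ler_pdivlMr// mulrC.
Qed.

(** Eliminating u by stationarity leaves a linear equation for (x, l) with continuous coefficients;
    it is solved backward from (1, QT). *)
Lemma hamiltonian_flow : exists (X : R -> 'M[R]_nx) (U : R -> 'M[R]_(nu, nx)) (L : R -> 'M[R]_nx),
  [/\ ccont T X, ccont T U, X T = 1%:M, L T = QT &
      forall t : R, t \in `[0, T] ->
      [/\ mder X t (A t *m X t + B t *m U t),
          mder L t (- ((A t)^T *m L t) - Q t *m X t - (H t)^T *m U t) &
          Rm t *m U t = - (H t *m X t + (B t)^T *m L t)]].
Proof.
pose iR t := invmx (Rm t).
have ciR : ccont T iR by apply: ccont_invmx => // t tT; exact: Rm_unit.
pose K t := block_mx (A t - B t *m (iR t *m H t)) (- (B t *m (iR t *m (B t)^T)))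
  (- Q t + (H t)^T *m (iR t *m H t)) (- (A t)^T + (H t)^T *m (iR t *m (B t)^T)).
have cK : ccont T K.
  apply: ccont_block.
  - by apply: ccontB => //; do 2 apply: ccontM => //.
  - by apply: ccontN; apply: ccontM => //; apply: ccontM => //; exact: ccont_tr.
  - apply: ccontD; first exact: ccontN.
    by apply: ccontM; [exact: ccont_tr|exact: ccontM].
  - apply: ccontD; first exact/ccontN/ccont_tr.
    by apply: ccontM; [exact: ccont_tr|apply: ccontM => //; exact: ccont_tr].
have [Z [ZT dZ]] := linear_ode_exists (col_mx 1%:M QT) T0 cK.
pose X t := usubmx (Z t); pose L t := dsubmx (Z t).
pose U t := - (iR t *m (H t *m X t + (B t)^T *m L t)).
have ZE t : Z t = col_mx (X t) (L t) by rewrite vsubmxK.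
have KZ t : K t *m Z t = col_mx
    (A t *m X t + B t *m U t)
    (- ((A t)^T *m L t) - Q t *m X t - (H t)^T *m U t).
  rewrite ZE /K mul_block_col /U; congr col_mx.
    rewrite mulmxBl !mulNmx mulmxN !mulmxDr !mulmxA opprD addrA.
    by rewrite -!mulmxA.
  rewrite !mulmxDl !mulNmx mulmxN opprK !mulmxDr !mulmxA.
  by rewrite !addrA; congr (_ + _); rewrite addrAC [- _ + _]addrC.
have dX t : t \in `[0, T] -> mder X t (A t *m X t + B t *m U t).
  move=> tT i j; have := dZ t tT (lshift nx i) j.
  rewrite KZ col_mxEu; congr (is_derive _ _ _ _).
  by apply/funext => s; rewrite ZE col_mxEu.
have dL t : t \in `[0, T] -> mder L t (- ((A t)^T *m L t) - Q t *m X t - (H t)^T *m U t).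
  move=> tT i j; have := dZ t tT (rshift nx i) j.
  rewrite KZ col_mxEd; congr (is_derive _ _ _ _).
  by apply/funext => s; rewrite ZE col_mxEd.
have cX := mder_ccont T0 dX; have cL := mder_ccont T0 dL.
have [XT LT] : X T = 1%:M /\ L T = QT by rewrite /X /L ZT col_mxKu col_mxKd.
exists X, U, L; split => //.
  apply: ccontN; apply: ccontM => //; apply: ccontD; first exact: ccontM.
  by apply: ccontM => //; exact: ccont_tr.
move=> t tT; split; [exact: dX|exact: dL|].
by rewrite /U mulmxN mulKVmx// Rm_unit.
Qed.

Lemma perturbation_bound x u l b t : ham x u l -> l T = QT *m x T + b ->
  t \in `[0, T] ->
  [/\ vnorm (x t) <= cz * vnorm (x 0) * expR (- (rho * t))
        + cz ^+ 2 * lb ^+ 2 / (2 * rho * gr) * vnorm b * expR (- (rho * (T - t))),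
      vnorm (l t) <= c1 * vnorm (x t) + cz * vnorm b * expR (- (rho * (T - t))) &
      vnorm (u t) <= (lh * vnorm (x t) + lb * vnorm (l t)) / gr].
Proof.
move=> hx lT tT.
have [X [U [L [cX cU XT LT hX]]]] := hamiltonian_flow.
have traj q : ham (fun s => X s *m q) (fun s => U s *m q) (fun s => L s *m q).
  move=> s sT; have [dX dL st] := hX s sT; split.
  - by rewrite !mulmxA -mulmxDl; exact: mderMr.
  - by apply: mder_eq (mderMr q dL) _; rewrite !mulmxBl mulNmx !mulmxA.
  - by rewrite !mulmxA st -mulmxDl mulNmx.
have trajT (q : 'cV[R]_nx) : L T *m q = QT *m (X T *m q) by rewrite LT XT mul1mx.
(* If X(s) q = 0, the value of this trajectory is 0 at s, hence at most 0 at T, where it is q.(QT q)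
   >= gq |q|^2. *)
have uX s : s \in `[0, T] -> X s \in unitmx.
  move=> sT; apply: unitmx_injective => q Xq.
  move: (sT); rewrite in_itv/= => /andP[s0 s1].
  have := value_nonincreasing (traj q) s0 s1 (lexx T).
  rewrite Xq dot0r => h1; have h2 := @value_final (fun s => X s *m q) (fun s => L s *m q) (trajT q).
  rewrite XT mul1mx in h1 h2; apply: dot_eq0; apply/eqP.
  rewrite eq_le dot_ge0 andbT -(pmulr_rle0 _ gq0) -sqr_vnorm.
  exact: le_trans h2 h1.
have decay q s r : 0 <= s -> s <= r -> r <= T ->
  vnorm (X r *m q) <= cz * expR (- (rho * (r - s))) * vnorm (X s *m q).
  by move=> *; exact: (state_decay (traj q) (trajT q)).
pose p s := invmx (X s) *m x s.
have Xp s : s \in `[0, T] -> X s *m p s = x s by move=> sT; rewrite mulKVmx// uX.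
pose g s := l s - L s *m p s.
have cz0 : 0 <= cz by exact: sqrtr_ge0.
(* The Wronskian with the trajectory from (s, xi) moves the terminal
   perturbation b to time s. *)
have gle s : s \in `[0, T] -> vnorm (g s) <= cz * expR (- (rho * (T - s))) * vnorm b.
  move=> sT; move: (sT); rewrite in_itv/= => /andP[s0 s1].
  apply: vnorm_le_dual => [|xi].
    by rewrite mulr_ge0 ?vnorm_ge0// mulr_ge0 ?expR_ge0.
  pose q := invmx (X s) *m xi; have Xq : X s *m q = xi by rewrite mulKVmx// uX.
  (* The second Wronskian is taken with the trajectory of parameter p(s), which has the state x(s)
     at time s; subtracting leaves only g at s and b at T. *)
  have w1 := wronskian (traj q) hx sT; have w2 := wronskian (traj q) (traj (p s)) sT.
  rewrite /= Xq Xp// in w1 w2.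
  have -> : dot xi (g s) = dot (X T *m q) b.
    rewrite /g dotDr dotNr; move: w1 w2; rewrite lT !trajT dotDr.
    have sym y : dot (QT *m (X T *m q)) y = dot (X T *m q) (QT *m y).
      by rewrite dot_mulmxl symQT.
    by rewrite !sym; lra.
  rewrite (le_trans (dot_le_vnorm _ _))// mulrA ler_wpM2r ?vnorm_ge0//.
  by rewrite mulrC -[in leRHS]Xq decay.
have lle : vnorm (l t) <= c1 * vnorm (x t) + cz * vnorm b * expR (- (rho * (T - t))).
  have -> : l t = L t *m p t + g t by rewrite addrC subrK.
  rewrite (le_trans (ler_vnormD _ _))// lerD//.
    by rewrite -[in leRHS]Xp//; exact: (adjoint_le (traj (p t)) (trajT (p t))).
  by rewrite mulrAC gle.
have ule : vnorm (u t) <= (lh * vnorm (x t) + lb * vnorm (l t)) / gr.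
  have [_ _ st] := hx t tT.
  have -> : u t = invmx (Rm t) *m (- (H t *m x t + (B t)^T *m l t)).
    by rewrite -st mulKmx// Rm_unit.
  rewrite (le_trans (bnd_invR _ tT))// ler_pM2r ?invr_gt0// vnormN.
  rewrite (le_trans (ler_vnormD _ _))// lerD ?bndH//.
  exact: vnorm_trmx_mulmx_le (ltW lb0) (bndB tT) _.
split=> //.
(* K is the closed-loop matrix, X' = K X. The inverse of X is obtained in differentiable form as the
   solution of Y' = - Y K with Y(T) = 1; the equation is transposed because [linear_ode_exists]
   multiplies from the left. *)
pose K s := A s + B s *m (U s *m invmx (X s)).
have cK : ccont T (fun s => - (K s)^T).
  apply/ccontN/ccont_tr/ccontD => //; apply: ccontM => //; apply: ccontM => //.
  exact: ccont_invmx.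
have [Z [ZT dZ]] := linear_ode_exists (1%:M : 'M[R]_nx) T0 cK.
pose Y s := (Z s)^T.
have dY s : s \in `[0, T] -> mder Y s (- (Y s *m K s)).
  move=> sT; apply: mder_eq (mder_tr (dZ s sT)) _.
  by rewrite mulNmx linearN/= trmx_mul trmxK.
have YX s : s \in `[0, T] -> Y s = invmx (X s).
  move=> sT; move: (sT); rewrite in_itv/= => /andP[s0 s1].
  have d r : r \in `[s, T] -> mder (fun r => Y r *m X r) r 0.
    move=> /(itv_sub s0 (lexx T)) rT; have [dX _ _] := hX r rT.
    apply: mder_eq (mderM (dY r rT) dX) _.
    rewrite /K mulNmx -!mulmxA mulmxDl -!mulmxA mulVmx ?uX// mulmx1.
    by rewrite addrC subrr.
  have := mder0_cst s1 d; rewrite XT /Y ZT trmx1 mulmx1 -/(Y s) => YXs.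
  by rewrite -[LHS]mulmx1 -(mulmxV (uX s sT)) mulmxA YXs mul1mx.
have dp s : s \in `[0, T] ->
    mder (fun r => Y r *m x r) s (Y s *m (B s *m (u s - U s *m p s))).
  move=> sT; have [dx _ _] := hx s sT.
  apply: mder_eq (mderM (dY s sT) dx) _.
  have -> : A s *m x s + B s *m u s = K s *m x s + B s *m (u s - U s *m p s).
    by rewrite /K mulmxDl mulmxBr -!mulmxA -/(p s) -addrA [X in _ = _ + X]addrC subrK.
  by rewrite mulmxDr mulNmx -mulmxA addKr.
have du s : s \in `[0, T] -> vnorm (u s - U s *m p s) <= lb * vnorm (g s) / gr.
  move=> sT; have [_ _ st] := hx s sT; have [_ _ st'] := hX s sT.
  have -> : u s - U s *m p s = invmx (Rm s) *m (- ((B s)^T *m g s)).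
    rewrite -[LHS](mulKmx (Rm_unit sT)); congr (_ *m _).
    rewrite mulmxBr st mulmxA st' mulNmx mulmxDl -!mulmxA Xp// /g mulmxBr.
    by rewrite opprK opprB opprD addrACA addNr add0r addrC.
  rewrite (le_trans (bnd_invR _ sT))// ler_pM2r ?invr_gt0// vnormN.
  exact: vnorm_trmx_mulmx_le (ltW lb0) (bndB sT) _.
move: (tT); rewrite in_itv/= => /andP[t0 tT'].
apply: vnorm_le_dual => [|eta].
  apply: addr_ge0; apply: (mulr_ge0 _ (expR_ge0 _)).
    exact: (mulr_ge0 cz0 (vnorm_ge0 _)).
  apply: (mulr_ge0 _ (vnorm_ge0 _)); apply: divr_ge0.
    exact: (mulr_ge0 (sqr_ge0 _) (sqr_ge0 _)).
  exact: (mulr_ge0 (mulr_ge0 (ler0n _ 2) (ltW rho0)) (ltW gr0)).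
(* The function f runs from eta.(X(t) X(0)^-1 x(0)) to eta.x(t). Its derivative is at most C
   exp(-rho (t-s)) exp(-rho (T-s)) in absolute value, and -h is a primitive of this product. *)
pose C := vnorm eta * (cz ^+ 2 * lb ^+ 2 / gr * vnorm b).
pose f s := dot eta (X t *m (Y s *m x s)).
pose f' s := dot eta (X t *m (Y s *m (B s *m (u s - U s *m p s)))).
pose h s := - (C / (2 * rho)) * expR (2 * rho * s + - (rho * (t + T))).
pose h' s := 2 * rho * (- (C / (2 * rho)) * expR (2 * rho * s + - (rho * (t + T)))).
have XYle s v : s \in `[0, t] ->
    vnorm (X t *m (Y s *m v)) <= cz * expR (- (rho * (t - s))) * vnorm v.
  move=> st; have sT := itv_sub (lexx 0) tT' st.
  move: st; rewrite in_itv/= => /andP[s0 s1].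
  by rewrite -[in leRHS](mulKVmx (uX s sT) v) -(YX s sT) decay.
have df s : s \in `[0, t] -> is_derive s 1 f (f' s).
  move=> /(itv_sub (lexx 0) tT') sT.
  apply: (is_derive_cast (derive_dot (mder_cst eta s) (mderMl (X t) (dp s sT)))).
  by rewrite dot0l add0r.
have f'le s : s \in `[0, t] -> `|f' s| <= - h' s.
  move=> st; have sT := itv_sub (lexx 0) tT' st.
  have -> : - h' s = C * expR (2 * rho * s + - (rho * (t + T))).
    by rewrite /h'; field; rewrite gt_eqF.
  rewrite /f'; set w := B s *m _; set v := X t *m (Y s *m w).
  have wle : vnorm w <= lb ^+ 2 / gr * vnorm (g s).
    rewrite (le_trans (bndB sT _))// (le_trans (ler_wpM2l (ltW lb0) (du s sT)))//.
    by rewrite le_eqVlt; apply/orP; left; apply/eqP; ring.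
  have lg0 : 0 <= lb ^+ 2 / gr by exact: divr_ge0 (sqr_ge0 _) (ltW gr0).
  have vle : vnorm eta * vnorm v <= C * expR (2 * rho * s + - (rho * (t + T))).
    have -> : C * expR (2 * rho * s + - (rho * (t + T))) = vnorm eta *
       (cz * expR (- (rho * (t - s))) *
        (lb ^+ 2 / gr * (cz * expR (- (rho * (T - s))) * vnorm b))).
      rewrite (_ : 2 * rho * s + - (rho * (t + T)) = - (rho * (t - s)) + - (rho * (T - s))); last by ring.
      by rewrite expRD /C; ring.
    rewrite ler_wpM2l ?vnorm_ge0// (le_trans (XYle s w st))//.
    rewrite ler_wpM2l ?(mulr_ge0 cz0 (expR_ge0 _))// (le_trans wle)//.
    by rewrite ler_wpM2l// gle.
  rewrite ler_norml; apply/andP; split; last exact: le_trans (dot_le_vnorm _ _) vle.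
  by rewrite lerNl -dotNr (le_trans (dot_le_vnorm _ _))// vnormN.
have := normr_sub_le_of_derive t0 df (fun s _ => is_derive_expR_affine _ _ _ s) f'le.
rewrite ler_norml => /andP[hf _].
have f0 : f 0 <= vnorm eta * (cz * expR (- (rho * t)) * vnorm (x 0)).
  rewrite (le_trans (dot_le_vnorm _ _))// ler_wpM2l ?vnorm_ge0//.
  by rewrite -[X in rho * X]subr0 XYle// in_itv/= lexx.
have -> : dot eta (x t) = f t by rewrite /f YX// Xp.
have -> : vnorm eta * (cz * vnorm (x 0) * expR (- (rho * t)) +
    cz ^+ 2 * lb ^+ 2 / (2 * rho * gr) * vnorm b * expR (- (rho * (T - t)))) =
  vnorm eta * (cz * expR (- (rho * t)) * vnorm (x 0)) + C / (2 * rho) * expR (- (rho * (T - t))).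
  by rewrite /C; field; rewrite !gt_eqF.
have hte : 2 * rho * t + - (rho * (t + T)) = - (rho * (T - t)) by ring.
have C0 : 0 <= C / (2 * rho) * expR (2 * rho * 0 + - (rho * (t + T))).
  apply: (mulr_ge0 _ (expR_ge0 _)); apply: divr_ge0; last by rewrite mulr_ge0// ltW.
  apply: mulr_ge0; first exact: vnorm_ge0.
  apply: mulr_ge0; last exact: vnorm_ge0.
  by apply: divr_ge0; [exact: (mulr_ge0 (sqr_ge0 _) (sqr_ge0 _))|exact: ltW].
rewrite hte in hf; lra.
Qed.

End ClosedLoop.

End HamiltonianSystem.

(** * The constants *)

Section Constants.
Context {R : realType}.

(** Used to pass from the open-loop rate [lamA] to [kappa]. The difference has derivative exp(2 b s)
    - exp(2 a s) >= 0. *)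
Lemma expint_le (a b t : R) : 0 < a -> a <= b -> 0 <= t -> expint a t <= expint b t.
Proof.
move=> a0 ab t0; have b0 := lt_le_trans a0 ab.
have d (s : R) : s \in `[0, t] -> is_derive s 1
    (fun s => (2 * b)^-1 * expR (2 * b * s + 0) - (2 * a)^-1 * expR (2 * a * s + 0))
    (expR (2 * b * s) - expR (2 * a * s)).
  move=> _; apply: (is_derive_cast (is_deriveB (is_derive_expR_affine _ _ _ s) (is_derive_expR_affine _ _ _ s))).
  by rewrite !addr0; field; rewrite !gt_eqF.
have := ge_of_derive_ge0 t0 d; rewrite /expint !mulr0 !addr0 expR0 => h.
have {h} := h _; rewrite !mulr1 => h.
have : (2 * b)^-1 - (2 * a)^-1 <=
   (2 * b)^-1 * expR (2 * b * t) - (2 * a)^-1 * expR (2 * a * t).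
  apply: h => s; rewrite in_itv/= => /andP[s0 _].
  by rewrite subr_ge0 ler_expR ler_wpM2r// ler_pM2l.
by lra.
Qed.

Variables (c : lq_bounds R).
Hypothesis hc : bounds_pos c.

Local Notation k := (kappa c).
Local Notation E := (expR (2 * k * sigma c)).

Let la0 : 0 < lamA c. Proof. by case: hc => -[]. Qed.
Let lb0 : 0 < lamB c. Proof. by case: hc => -[]. Qed.
Let lq0 : 0 < lamQ c. Proof. by case: hc => -[]. Qed.
Let lh0 : 0 < lamH c. Proof. by case: hc => -[]. Qed.
Let lr0 : 0 < lamR c. Proof. by case: hc => -[]. Qed.
Let lg0 : 0 < lamG c. Proof. by case: hc => _ -[]. Qed.
Let gr0 : 0 < gamR c. Proof. by case: hc => _ _ []. Qed.
Let gq0 : 0 < gamQ c. Proof. by case: hc => _ _ []. Qed.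
Let a00 : 0 < alpha0 c. Proof. by case: hc => _ _ _ []. Qed.
Let a10 : 0 < alpha1 c. Proof. by case: hc => _ _ _ []. Qed.
Let sg0 : 0 < sigma c. Proof. by case: hc. Qed.

Lemma kappa_ge : lamA c <= k.
Proof. by rewrite lerDl divr_ge0 ?mulr_ge0// ltW. Qed.

Let k0 : 0 < k. Proof. exact: lt_le_trans la0 kappa_ge. Qed.

Let E1 : 1 < E.
Proof. by rewrite -expR0 ltr_expR !mulr_gt0. Qed.

Let E0 : 0 < E. Proof. exact: expR_gt0. Qed.

Lemma expint_gt0 (a t : R) : 0 < a -> 0 < t -> 0 < expint a t.
Proof.
by move=> ? ?; rewrite divr_gt0 ?mulr_gt0// subr_gt0 -expR0 ltr_expR !mulr_gt0.
Qed.

Lemma alpha1'E : alpha1' c = lamB c ^+ 2 * expint k (sigma c).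
Proof. by rewrite /alpha1' /expint mulrA. Qed.

Lemma invr_alpha0' : (alpha0' c)^-1 = 2 / alpha0 c
  + 2 * (lamH c / gamR c) ^+ 2 * (1 + alpha1 c / alpha0 c) ^+ 2 * expint (lamA c) (sigma c).
Proof. by rewrite invrK /expint; field; rewrite !gt_eqF. Qed.

Let i0 : 2 / alpha0 c <= (alpha0' c)^-1.
Proof.
rewrite invr_alpha0' lerDl; apply: (mulr_ge0 _ (ltW (expint_gt0 la0 sg0))).
by apply: (mulr_ge0 _ (sqr_ge0 _)); exact: (mulr_ge0 _ (sqr_ge0 _)).
Qed.

Let ipos : 0 < (alpha0' c)^-1.
Proof. by apply: lt_le_trans i0; rewrite divr_gt0. Qed.

Lemma c1_gt0 : 0 < c1 c.
Proof.
rewrite mulr_gt0// lt_max; apply/orP; right.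
rewrite mulr_gt0// addr_gt0// ?divr_gt0 ?mulr_gt0// exprn_gt0//.
Qed.

Let lq_le : lamQ c <= lamQ c + lamH c ^+ 2 / gamR c.
Proof. by rewrite lerDl divr_ge0 ?sqr_ge0// ltW. Qed.

Let expint_k_le : expint k (sigma c) <= E / (2 * k).
Proof. by rewrite ler_pM2r ?invr_gt0 ?mulr_gt0// gerDl lerN10. Qed.

(** This is what the second argument of the maximum in [c1] accounts for. *)
Lemma free_cost_le_c1 :
  lamQ c * (expint (lamA c) (sigma c) + expR (2 * lamA c * sigma c)) <= c1 c.
Proof.
have h1 := le_trans (expint_le la0 kappa_ge (ltW sg0)) expint_k_le.
have h2 : expR (2 * lamA c * sigma c) <= E.
  by rewrite ler_expR ler_pM2r// ler_pM2l// kappa_ge.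
apply: (@le_trans _ _ ((lamQ c + lamH c ^+ 2 / gamR c) * (1 + 1 / (2 * k)) * E)).
  have -> : (lamQ c + lamH c ^+ 2 / gamR c) * (1 + 1 / (2 * k)) * E =
    (lamQ c + lamH c ^+ 2 / gamR c) * (E / (2 * k) + E) by ring.
  apply: ler_pM => //; first exact: ltW.
    by rewrite addr_ge0 ?expR_ge0// ltW// expint_gt0.
  exact: lerD.
by rewrite ler_pM2r// le_max lexx orbT.
Qed.

(** This is the first argument of the maximum. The premise says that the lower Gramian bound does
    not exceed the computed upper one; it yields 1 <= [alpha1'] / [alpha0'], and multiplying by this
    ratio turns the linear term in 1 / [alpha0'] into the quadratic one of [c1]. *)
Lemma steered_cost_le_c1 : alpha0 c <= lamB c ^+ 2 * expint (lamA c) (sigma c) ->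
  lamQ c * (1 + lamB c ^+ 2 * expint (lamA c) (sigma c) / alpha0 c) ^+ 2
    * expint (lamA c) (sigma c)
  + lamR c * (2 / alpha0 c + 2 * (lamH c / gamR c) ^+ 2
      * (1 + alpha1 c / alpha0 c) ^+ 2 * expint (lamA c) (sigma c)) <= c1 c.
Proof.
move=> h; rewrite -invr_alpha0'; have i00 := i0; have ip := ipos.
set i := (alpha0' c)^-1 in i00 ip *.
have F0 := expint_gt0 la0 sg0; have FF := expint_le la0 kappa_ge (ltW sg0).
set F := expint (lamA c) _ in h F0 FF *.
have F'E := expint_k_le; set F' := expint k _ in FF F'E.
have F'0 := lt_le_trans F0 FF.
have a1E : alpha1' c = lamB c ^+ 2 * F' by exact: alpha1'E.
have b20 : 0 < lamB c ^+ 2 by rewrite exprn_gt0.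
have a1a : lamB c ^+ 2 * F <= alpha1' c by rewrite a1E ler_pM2l.
have a1'0 : 0 < alpha1' c by rewrite a1E mulr_gt0.
have iinv : (alpha0 c)^-1 <= i.
  by rewrite (le_trans _ i00)// -[leLHS]mul1r ler_pM2r ?invr_gt0// ler1n.
have a1i : 1 <= alpha1' c * i.
  rewrite -(divff (lt0r_neq0 a00)); apply: ler_pM => //; [exact: ltW|by rewrite invr_ge0 ltW|].
  exact: le_trans h a1a.
have t1 : lamQ c * (1 + lamB c ^+ 2 * F / alpha0 c) ^+ 2 * F <=
   (lamQ c + lamH c ^+ 2 / gamR c) * (1 + alpha1' c * i) ^+ 2 * (E / (2 * k)).
  apply: ler_pM; [|exact: ltW| |exact: le_trans FF F'E].
    exact: (mulr_ge0 (ltW lq0) (sqr_ge0 _)).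
  apply: ler_pM => //; [exact: ltW|exact: sqr_ge0|].
  have p : 0 <= lamB c ^+ 2 * F / alpha0 c by rewrite ltW// divr_gt0// mulr_gt0.
  have q : lamB c ^+ 2 * F / alpha0 c <= alpha1' c * i.
    by apply: ler_pM => //; [rewrite mulr_ge0// ltW|rewrite invr_ge0 ltW].
  by rewrite ler_sqr ?nnegrE ?lerD2l// addr_ge0// (le_trans p).
have t2 : lamR c * i <= lamR c * lamB c ^+ 2 * i ^+ 2 * (E / (2 * k)).
  apply: (@le_trans _ _ (lamR c * i * (alpha1' c * i))).
    by rewrite -[leLHS]mulr1 ler_wpM2l// mulr_ge0// ltW.
  have -> : lamR c * i * (alpha1' c * i) = lamR c * lamB c ^+ 2 * i ^+ 2 * F' by rewrite a1E; ring.
  by rewrite ler_wpM2l// !mulr_ge0 ?sqr_ge0// ltW.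
apply: (le_trans (lerD t1 t2)).
apply: (@le_trans _ _ (1 / (2 * k)
     * ((lamQ c + lamH c ^+ 2 / gamR c) * (1 + alpha1' c / alpha0' c) ^+ 2
        + lamR c * lamB c ^+ 2 / alpha0' c ^+ 2) * E)).
  by rewrite -exprVn -/i le_eqVlt; apply/orP; left; apply/eqP; ring.
by rewrite ler_pM2r// le_max lexx.
Qed.

(** N1 and N2 are the quantities inverted in the two arguments of the minimum defining [c0]. *)
Let N1 := lamB c ^+ 2 / gamR c * (1 + talpha1 c / talpha0 c) ^+ 2
  + 1 / (gamQ c * talpha0 c ^+ 2).
Let N2 := lamB c ^+ 2 / (2 * gamR c * k) + 1 / gamQ c.

Let m := (talpha0 c)^-1.

Let Em0 : 0 < 1 - E^-1.
Proof. by rewrite subr_gt0 invf_lt1. Qed.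

Let mE : m * (1 - E^-1) = 2 * k.
Proof. by rewrite /m /talpha0 expRN invf_div divfK// gt_eqF. Qed.

Let m0 : 0 < m.
Proof. by rewrite /m /talpha0 invr_gt0 expRN divr_gt0 ?mulr_gt0. Qed.

Let N10 : 0 < N1.
Proof.
rewrite ltr_wpDl//; last by rewrite divr_gt0// mulr_gt0// exprn_gt0// -invr_gt0.
by apply: (mulr_ge0 _ (sqr_ge0 _)); exact: divr_ge0 (sqr_ge0 _) (ltW gr0).
Qed.

Let N20 : 0 < N2.
Proof. by rewrite addr_gt0// divr_gt0 ?mulr_gt0 ?exprn_gt0. Qed.

Lemma c0_gt0 : 0 < c0 c.
Proof.
by rewrite mulr_gt0 ?expR_gt0// lt_min mulr_gt0 ?mulr_gt0 ?invr_gt0//= invr_gt0.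
Qed.

Lemma c0_le_gamQ : c0 c <= gamQ c.
Proof.
have h : c0 c <= N2^-1 * E^-1.
  by rewrite /c0 expRN ler_pM2r ?invr_gt0// ge_min lexx orbT.
rewrite (le_trans h)//.
have h1 : N2^-1 <= gamQ c.
  rewrite -[leRHS]invrK lef_pV2 ?posrE ?invr_gt0// /N2 div1r lerDr.
  by rewrite divr_ge0 ?sqr_ge0// !mulr_ge0// ltW.
have h2 : E^-1 <= 1 by rewrite invf_le1// ltW.
by rewrite -[leRHS]mulr1 ler_pM// invr_ge0 ltW.
Qed.

(** The discriminant condition of [value_ge]. With m = 1 / [talpha0], each of c0 lamB^2 / gamR, 2
    kappa and 1 / sigma is at most m, while c0 m <= gamQ / 4; so the three terms together take at
    most 3/4 of gamQ. *)
Lemma c0_quadratic : c0 c ^+ 2 * lamB c ^+ 2 <=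
  gamR c * (gamQ c - c0 c * ((sigma c)^-1 + 2 * k)).
Proof.
have c00 := c0_gt0; set C := c0 c in c00 *.
have h : C * E * N1 <= 2 * k.
  have : C <= 2 * k * N1^-1 * E^-1.
    by rewrite /C /c0 expRN ler_pM2r ?invr_gt0// ge_min lexx.
  by rewrite ler_pdivlMr// ler_pdivlMr.
have p0 : 0 <= lamB c ^+ 2 / gamR c by rewrite divr_ge0 ?sqr_ge0// ltW.
have N1E : N1 = lamB c ^+ 2 / gamR c * (1 + talpha1 c / talpha0 c) ^+ 2 + m ^+ 2 / gamQ c.
  by congr (_ + _); rewrite /m exprVn div1r invfM mulrC.
have q0 : 0 <= talpha1 c / talpha0 c.
  apply: (mulr_ge0 _ (ltW m0)); apply: divr_ge0; first by rewrite subr_ge0 ltW.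
  by rewrite mulr_ge0// ltW.
have r1 : 1 <= (1 + talpha1 c / talpha0 c) ^+ 2.
  by rewrite -[leLHS](expr1n _ 2) ler_sqr ?nnegrE ?lerDl// addr_ge0.
set r := (_ + _) ^+ 2 in N1E r1.
have CE0 : 0 < C * E by rewrite mulr_gt0.
have hX : C * (lamB c ^+ 2 / gamR c) <= 2 * k.
  apply: le_trans h; rewrite N1E mulrDr.
  have e1 : C * (lamB c ^+ 2 / gamR c) <= C * E * (lamB c ^+ 2 / gamR c * r).
    apply: ler_pM => //; first exact: ltW.
      by rewrite -[leLHS]mulr1 ler_pM2l// ltW.
    by rewrite -[leLHS]mulr1 ler_wpM2l.
  have e2 : 0 <= C * E * (m ^+ 2 / gamQ c).
    by apply: (mulr_ge0 (ltW CE0)); exact: divr_ge0 (sqr_ge0 _) (ltW gq0).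
  by lra.
have hY : C * E * m ^+ 2 <= gamQ c * (2 * k).
  rewrite -ler_pdivrMl//; apply: le_trans h; rewrite N1E [leRHS]mulrDr.
  have e1 : 0 <= C * E * (lamB c ^+ 2 / gamR c * r).
    by apply: (mulr_ge0 (ltW CE0)); apply: mulr_ge0 => //; exact: le_trans r1.
  have -> : (gamQ c)^-1 * (C * E * m ^+ 2) = C * E * (m ^+ 2 / gamQ c) by ring.
  by lra.
have hm : C * m <= gamQ c / 4.
  have e1 : C * E * m <= gamQ c * (1 - E^-1).
    have r2 : gamQ c * (1 - E^-1) * m = gamQ c * (2 * k).
      by rewrite mulrAC -mulrA mE.
    by rewrite -(ler_pM2r m0) r2 (_ : C * E * m * m = C * E * m ^+ 2)// expr2 mulrA.
  (* The factor 1/4 is the maximum of y (1 - y), here at y = 1 / E. *)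
  have e2 : (1 - E^-1) * E^-1 <= 4^-1.
    have := sqr_ge0 (E^-1 - 2^-1); lra.
  have -> : C * m = C * E * m * E^-1 by field; rewrite gt_eqF.
  apply: (@le_trans _ _ (gamQ c * (1 - E^-1) * E^-1)).
    by rewrite ler_pM2r ?invr_gt0.
  by rewrite -mulrA ler_pM2l.
have km : 2 * k <= m.
  by rewrite -mE -[leRHS]mulr1 ler_pM2l// gerDl oppr_le0 invr_ge0 ltW.
have sm : (sigma c)^-1 <= m.
  (* The inequality 1 - exp(-y) <= y, at y = 2 kappa sigma. *)
  have h1 : 1 - E^-1 <= 2 * k * sigma c.
    by have := expR_ge1Dx (- (2 * k * sigma c)); rewrite expRN; lra.
  rewrite -(ler_pM2r Em0) mE -(ler_pM2r sg0) mulrAC mulVf ?gt_eqF// mul1r.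
  exact: h1.
have f1 := ler_wpM2l (ltW c00) km; have f2 := ler_wpM2l (ltW c00) sm.
have f3 := ler_wpM2l (ltW c00) hX; have f4 := gq0.
have -> : C ^+ 2 * lamB c ^+ 2 = gamR c * (C * (C * (lamB c ^+ 2 / gamR c))) by field; rewrite gt_eqF.
by rewrite (ler_pM2l gr0); lra.
Qed.

Lemma rhoZ_gt0 : 0 < rhoZ c.
Proof. by rewrite divr_gt0// mulr_gt0// c1_gt0. Qed.

Lemma cZ_gt0 : 0 < cZ c.
Proof. by rewrite sqrtr_gt0 divr_gt0 ?c1_gt0 ?c0_gt0. Qed.

Lemma Lambda_b_gt0 : 0 < Lambda_b c.
Proof.
rewrite mulr_gt0 ?lt_max ?cZ_gt0// !addr_gt0 ?divr_gt0// mulr_gt0 ?addr_gt0 ?divr_gt0//.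
exact: c1_gt0.
Qed.

End Constants.

(** * From the control problem to the Hamiltonian system *)

Section Evolution.
Context {R : realType} {n : nat}.
Variables (T la : R) (A : R -> 'M[R]_n) (Phi : R -> R -> 'M[R]_n).
Hypotheses (T0 : 0 <= T) (cA : ccont T A).
Hypothesis bndA : forall t : R, t \in `[0, T] -> forall v, vnorm (A t *m v) <= la * vnorm v.
Hypothesis evol : evolution_operator T A Phi.

(** [Phi] satisfies an integrated equation on [0, T] only; rebuilding it from a primitive gives a
    function with two-sided derivatives at the end points too. *)
Lemma evolution_flow (s : R) : s \in `[0, T] -> exists Psi : R -> 'M[R]_n,
  (forall t : R, t \in `[0, T] -> Psi t = Phi t s) /\
  (forall t : R, t \in `[0, T] -> mder Psi t (A t *m Psi t)).
Proof.
move=> sT; have [Phi1 Phic Phieq] := evol sT.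
have cF : ccont T (fun t => A t *m Phi t s) by apply: ccontM => //; exact: within_ccont.
have [G dG] := mprimitive_exists cF.
have PsiE (t : R) : t \in `[0, T] -> 1%:M + (G t - G s) = Phi t s.
  move=> tT; move: (tT) (sT); rewrite !in_itv/= => /andP[t0 tT'] /andP[s0 sT'].
  have [st|/ltW ts] := leP s t.
    by rewrite -(mxint_ccont s0 st tT' cF dG) -Phieq// Phi1 addrC subrK.
  by rewrite -opprB -(mxint_ccont t0 ts sT' cF dG) -Phieq// Phi1 opprB addrC subrK.
exists (fun t => 1%:M + (G t - G s)); split => // t tT.
apply: mder_eq (mderD (mder_cst _ t) (mderB (dG t tT) (mder_cst _ t))) _.
by rewrite subr0 add0r PsiE.
Qed.

Lemma flow_unique (x : R -> 'cV[R]_n) (s t : R) : s \in `[0, T] -> t \in `[0, T] ->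
  (forall r : R, r \in `[0, T] -> mder x r (A r *m x r)) -> x s = 0 -> x t = 0.
Proof.
rewrite !in_itv/= => /andP[s0 sT] /andP[t0 tT] dx xs0.
apply: vnorm0_eq0; apply/eqP; rewrite eq_le vnorm_ge0 andbT.
have [st|/ltW ts] := leP s t.
  by have [h _] := flow_growth bndA s0 st tT dx; rewrite (le_trans h)// xs0 vnorm0 mulr0.
by have [_ h] := flow_growth bndA t0 ts sT dx; rewrite (le_trans h)// xs0 vnorm0 mulr0.
Qed.

Lemma evolution_inv (s t : R) : s \in `[0, T] -> t \in `[0, T] ->
  Phi s t *m Phi t s = 1%:M.
Proof.
move=> sT tT; have [X [XE dX]] := evolution_flow sT.
have [Y [YE dY]] := evolution_flow tT.
have [Phis _ _] := evol sT; have [Phit _ _] := evol tT.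
pose D r := X r - Y r *m Phi t s.
have dD r : r \in `[0, T] -> mder D r (A r *m D r).
  move=> rT; apply: mder_eq (mderB (dX r rT) (mderMr _ (dY r rT))) _.
  by rewrite /D mulmxBr mulmxA.
have Dt : D t = 0 by rewrite /D XE// YE// Phit mul1mx subrr.
suff : D s = 0.
  by move/eqP; rewrite /D XE// YE// Phis subr_eq0 => /eqP.
apply/matrixP => i j.
have : D s *m (delta_mx j 0 : 'cV[R]_n) = 0.
  apply: (@flow_unique (fun r => D r *m delta_mx j 0) t s tT sT); last by rewrite Dt mul0mx.
  by move=> r rT; rewrite mulmxA; exact/mderMr/dD.
by rewrite -colE => /matrixP/(_ i 0); rewrite !mxE.
Qed.

(** Supplies the data of the steering argument. [evolution_operator] states continuity in the first
    time variable; continuity of [Phi t0 t] in t comes from writing it as the inverse of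
    [Phi t t0]. *)
Lemma evolution_gramian m (B : R -> 'M[R]_(n, m)) (t0 : R) : ccont T B ->
  t0 \in `[0, T] -> exists Psi Th W : R -> 'M[R]_n,
  [/\ forall t : R, t \in `[0, T] -> mder Psi t (A t *m Psi t),
      Psi t0 = 1%:M,
      forall t : R, t \in `[0, T] -> Psi t *m Th t = 1%:M,
      forall t : R, t \in `[0, T] -> mder W t (Th t *m B t *m (B t)^T *m (Th t)^T) &
      W t0 = 0 /\ forall t1, t0 <= t1 -> t1 <= T -> W t1 = gramian Phi B t0 t1].
Proof.
move=> cB t0T; have [Psi [PsiE dPsi]] := evolution_flow t0T.
have [Phi1 _ _] := evol t0T.
have inv t : t \in `[0, T] -> Psi t *m Phi t0 t = 1%:M.
  by move=> tT; rewrite PsiE// evolution_inv.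
have ThE t : t \in `[0, T] -> Phi t0 t = invmx (Psi t).
  by move=> tT; have /mulmx1_unit[u _] := inv t tT; rewrite -[LHS](mulKmx u) inv// mulmx1.
have cTh : ccont T (fun t => invmx (Psi t)).
  apply: ccont_invmx => //; last exact: mder_ccont dPsi.
  by move=> t tT; have /mulmx1_unit[] := inv t tT.
have cF : ccont T (fun t => invmx (Psi t) *m B t *m (B t)^T *m (invmx (Psi t))^T).
  apply: ccontM; last exact: ccont_tr.
  by apply: ccontM; [exact: ccontM|exact: ccont_tr].
have [G dG] := mprimitive_exists cF.
exists Psi, (fun t => invmx (Psi t)), (fun t => G t - G t0); split => //.
- by rewrite PsiE.
- by move=> t tT; rewrite -ThE// inv.
- move=> t tT; apply: mder_eq (mderB (dG t tT) (mder_cst _ t)) _.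
  by rewrite subr0.
split=> [|t1 t01 t1T]; first by rewrite subrr.
move: t0T; rewrite in_itv/= => /andP[t00 _].
rewrite -(mxint_ccont t00 t01 t1T cF dG); apply/matrixP => i j; rewrite !mxE.
apply: eq_Rintegral => s; rewrite inE/= => /(itv_sub t00 t1T) sT.
by rewrite -ThE.
Qed.

End Evolution.

Section Difference.
Context {R : realType} {nx nu nd : nat}.
Variables (T : R) (P : lq_data R nx nu nd).
Hypothesis T0 : 0 <= T.
Hypotheses (cA : ccont T (mA P)) (cB : ccont T (mB P)) (cC : ccont T (mC P)).
Hypotheses (cQ : ccont T (mQ P)) (cH : ccont T (mH P)) (cR : ccont T (mR P)).
Hypothesis cG : ccont T (mG P).
Hypothesis uR : forall t : R, t \in `[0, T] -> mR P t \in unitmx.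

Lemma optimal_triple_sub d d0 l0 dT lT xs us ls xp up lp :
  bounded_measurable T d ->
  optimal_triple T P d d0 dT xs us ls ->
  optimal_triple T P d (d0 + l0) (dT + lT) xp up lp ->
  exists x u l, [/\ ham T (mA P) (mB P) (mQ P) (mH P) (mR P) x u l,
    x 0 = l0, l T = mQT P *m x T + (mGT P)^T *m lT &
    forall t : R, t \in `[0, T] ->
      [/\ xp t - xs t = x t, up t - us t = u t & lp t - ls t = l t]].
Proof.
move=> hd [[[ms [cxs es]] _] [cls as_] ps] [[[mp [cxp ep]] _] [clp ap] pp].
have T0in : 0 \in `[0, T] by rewrite in_itv/= lexx.
have TTin : T \in `[0, T] by rewrite in_itv/= lexx andbT.
have {}cxs := within_ccont T0 cxs; have {}cxp := within_ccont T0 cxp.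
have {}cls := within_ccont T0 cls; have {}clp := within_ccont T0 clp.
have {}ms := bounded_measurable_mxbm ms; have {}mp := bounded_measurable_mxbm mp.
have {}hd := bounded_measurable_mxbm hd.
pose x t := xp t - xs t; pose l t := lp t - ls t.
have cx : ccont T x by exact: ccontB. have cl : ccont T l by exact: ccontB.
(* The two controls are only bounded and measurable, but d cancels in the difference of their
   pointwise formulas, so this difference is continuous and the differential equations hold
   classically. *)
pose u t := - (invmx (mR P t) *m (mH P t *m x t + (mB P t)^T *m l t)).
have cu : ccont T u.
  apply/ccontN/ccontM; first exact: ccont_invmx.
  by apply: ccontD; apply: ccontM => //; exact: ccont_tr.
have uE t : t \in `[0, T] -> up t - us t = u t.
  move=> tT; rewrite pp// ps// -opprD -mulmxBr; congr (- (_ *m _)).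
  by rewrite opprD addrACA subrr addr0 opprD addrACA -!mulmxBr.
have sub a b t : 0 <= a -> b <= T -> `[a, b]%classic t -> t \in `[0, T].
  by move=> a0 bT /(itv_sub a0 bT).
pose F t := mA P t *m x t + mB P t *m u t.
have cF : ccont T F by apply: ccontD; exact: ccontM.
have [X dX] := mprimitive_exists cF.
pose F' t := (mA P t)^T *m l t + mQ P t *m x t + (mH P t)^T *m u t.
have cF' : ccont T F'.
  by apply: ccontD; [apply: ccontD|]; apply: ccontM => //; exact: ccont_tr.
have [L dL] := mprimitive_exists cF'.
have bmF y v : ccont T y -> mxbm T v ->
    mxbm T (fun t => mA P t *m y t + mB P t *m v t + mC P t *m d t).
  move=> cy mv; exact: (mxbmD (mxbmD (mxbmM (ccont_mxbm cA) (ccont_mxbm cy))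
    (mxbmM (ccont_mxbm cB) mv)) (mxbmM (ccont_mxbm cC) hd)).
have bmF' k y v : ccont T k -> ccont T y -> mxbm T v ->
    mxbm T (fun t => (mA P t)^T *m k t + mQ P t *m y t + (mH P t)^T *m v t + (mG P t)^T *m d t).
  move=> ck cy mv; exact: (mxbmD (mxbmD (mxbmD
    (mxbmM (ccont_mxbm (ccont_tr cA)) (ccont_mxbm ck)) (mxbmM (ccont_mxbm cQ) (ccont_mxbm cy)))
    (mxbmM (ccont_mxbm (ccont_tr cH)) mv)) (mxbmM (ccont_mxbm (ccont_tr cG)) hd)).
have xE t : t \in `[0, T] -> x t = l0 + (X t - X 0).
  move=> tT; move: (tT); rewrite in_itv/= => /andP[t0 tT'].
  rewrite -(mxint_ccont (lexx 0) t0 tT' cF dX) /x ep// es//.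
  rewrite opprD addrACA [d0 + l0]addrC addrK (mxintB (lexx 0) tT' (bmF _ _ cxp mp) (bmF _ _ cxs ms)).
  congr (_ + _); apply/matrixP => i j; rewrite !mxE; apply: eq_Rintegral => s.
  rewrite inE => /(sub 0 t s (lexx 0) tT') sT; congr (fun_of_matrix _ i j).
  rewrite /F -uE// /x opprD addrACA subrr addr0 opprD addrACA.
  by rewrite -!mulmxBr.
have lE t : t \in `[0, T] -> l t = mQT P *m x T + (mGT P)^T *m lT + (L T - L t).
  move=> tT; move: (tT); rewrite in_itv/= => /andP[t0 tT'].
  rewrite -(mxint_ccont t0 tT' (lexx T) cF' dL) /l ap// as_//.
  rewrite opprD addrACA (mxintB t0 (lexx T) (bmF' _ _ _ clp cxp mp) (bmF' _ _ _ cls cxs ms)).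
  congr (_ + _).
    by rewrite opprD addrACA -!mulmxBr [dT + lT]addrC addrK.
  apply/matrixP => i j; rewrite !mxE; apply: eq_Rintegral => s.
  rewrite inE => /(sub t T s t0 (lexx T)) sT; congr (fun_of_matrix _ i j).
  rewrite /F' -uE// /x /l opprD addrACA subrr addr0 !opprD.
  by rewrite addrACA [X in X + _]addrACA -!mulmxBr.
(* On [0, T] these are the differences of the states and of the adjoints; the primitives continue
   them differentiably past both end points. *)
exists (fun t => l0 + (X t - X 0)), u,
  (fun t => mQT P *m x T + (mGT P)^T *m lT + (L T - L t)); split.
- move=> t tT; rewrite -xE// -lE//; split.
  + apply: mder_eq (mderD (mder_cst _ t) (mderB (dX t tT) (mder_cst _ t))) _.
    by rewrite subr0 add0r.
  + apply: mder_eq (mderD (mder_cst _ t) (mderB (mder_cst _ t) (dL t tT))) _.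
    by rewrite !add0r /F' !opprD.
  + by rewrite /u mulmxN mulKVmx// uR.
- by rewrite subrr addr0.
- by rewrite subrr addr0 -xE.
- by move=> t tT; rewrite -xE// -lE// uE.
Qed.

End Difference.

(** * The estimate *)

Section Estimate.
Context {R : realType} {nx nu nd : nat}.
Variables (c : lq_bounds R) (T : R) (P : lq_data R nx nu nd).
Hypothesis hc : bounds_pos c.
Hypothesis hsym : symmetric_weights T P.
Hypothesis hbnd : bounded_coefficients c T P.
Hypothesis hctrl : uniformly_completely_controllable c T P.
Hypothesis hconv : strongly_convex_weights c T P.
Hypothesis hpar : bounded_parameter_coefficients c T P.

Let la0 : 0 < lamA c. Proof. by case: hc => -[]. Qed.
Let lb0 : 0 < lamB c. Proof. by case: hc => -[]. Qed.
Let lq0 : 0 < lamQ c. Proof. by case: hc => -[]. Qed.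
Let lh0 : 0 < lamH c. Proof. by case: hc => -[]. Qed.
Let lr0 : 0 < lamR c. Proof. by case: hc => -[]. Qed.
Let lg0 : 0 < lamG c. Proof. by case: hc => _ -[]. Qed.
Let gr0 : 0 < gamR c. Proof. by case: hc => _ _ []. Qed.
Let gq0 : 0 < gamQ c. Proof. by case: hc => _ _ []. Qed.
Let a00 : 0 < alpha0 c. Proof. by case: hc => _ _ _ []. Qed.
Let a10 : 0 < alpha1 c. Proof. by case: hc => _ _ _ []. Qed.
Let sg0 : 0 < sigma c. Proof. by case: hc. Qed.

Let sgT : sigma c < T. Proof. by case: hctrl. Qed.
Let T0 : 0 <= T. Proof. exact: ltW (lt_trans sg0 sgT). Qed.

Let symQ t : t \in `[0, T] -> (mQ P t)^T = mQ P t.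
Proof. by case: hsym => h _ /h[]. Qed.
Let symR t : t \in `[0, T] -> (mR P t)^T = mR P t.
Proof. by case: hsym => h _ /h[]. Qed.
Let symQT : (mQT P)^T = mQT P. Proof. by case: hsym. Qed.

Let bndA t : t \in `[0, T] -> forall v, vnorm (mA P t *m v) <= lamA c * vnorm v.
Proof. by case: hbnd => -[_ h] _ _ _ _ tT v; exact: sup_opnorm_mulmx_le h. Qed.
Let bndB t : t \in `[0, T] -> forall v, vnorm (mB P t *m v) <= lamB c * vnorm v.
Proof. by case: hbnd => _ [_ h] _ _ _ tT v; exact: sup_opnorm_mulmx_le h. Qed.
Let bndQ t : t \in `[0, T] -> forall v, vnorm (mQ P t *m v) <= lamQ c * vnorm v.
Proof. by case: hbnd => _ _ [_ h] _ _ tT v; exact: sup_opnorm_mulmx_le h. Qed.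
Let bndH t : t \in `[0, T] -> forall v, vnorm (mH P t *m v) <= lamH c * vnorm v.
Proof. by case: hbnd => _ _ _ [_ h] _ tT v; exact: sup_opnorm_mulmx_le h. Qed.
Let bndR t : t \in `[0, T] -> forall v, vnorm (mR P t *m v) <= lamR c * vnorm v.
Proof. by case: hbnd => _ _ _ _ [_ h] tT v; exact: sup_opnorm_mulmx_le h. Qed.

Let cA : ccont T (mA P). Proof. by case: hbnd => -[/(within_ccont T0)]. Qed.
Let cB : ccont T (mB P). Proof. by case: hbnd => _ [/(within_ccont T0)]. Qed.
Let cQ : ccont T (mQ P). Proof. by case: hbnd => _ _ [/(within_ccont T0)]. Qed.
Let cH : ccont T (mH P). Proof. by case: hbnd => _ _ _ [/(within_ccont T0)]. Qed.
Let cR : ccont T (mR P). Proof. by case: hbnd => _ _ _ _ [/(within_ccont T0)]. Qed.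
Let cG : ccont T (mG P). Proof. by case: hpar => -[/(within_ccont T0)]. Qed.
Let cC : ccont T (mC P). Proof. by case: hpar => _ _ [/(within_ccont T0)]. Qed.

Let coeR t : t \in `[0, T] -> loewner_le (gamR c)%:M (mR P t).
Proof. by case: hconv => h _ /h[]. Qed.
Let coeQ t : t \in `[0, T] ->
  loewner_le (gamQ c)%:M (mQ P t - (mH P t)^T *m invmx (mR P t) *m mH P t).
Proof. by case: hconv => h _ /h[]. Qed.
Let QT_ge : loewner_le (gamQ c)%:M (mQT P). Proof. by case: hconv => _ []. Qed.
Let QT_le : loewner_le (mQT P) (lamQ c)%:M. Proof. by case: hconv => _ []. Qed.

Local Notation hamP := (ham T (mA P) (mB P) (mQ P) (mH P) (mR P)).

Lemma value_lower x u l : hamP x u l -> l T = mQT P *m x T ->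
  forall t : R, t \in `[0, T] -> c0 c * vnorm (x t) ^+ 2 <= dot (l t) (x t).
Proof.
move=> hx lT t tT.
exact: (value_ge la0 lb0 lh0 gr0 gq0 symQ symR bndA bndB bndH coeR coeQ QT_ge
  sg0 (c0_gt0 hc) (c0_le_gamQ hc) (c0_quadratic hc) hx lT tT).
Qed.

Lemma value_upper x u l : hamP x u l -> l T = mQT P *m x T ->
  forall t : R, t \in `[0, T] -> forall xi,
  2 * dot (l t) xi <= dot (l t) (x t) + c1 c * vnorm xi ^+ 2.
Proof.
move=> hx lT t tT xi; move: (tT); rewrite in_itv/= => /andP[t0 tT'].
have [_ [Phi [evol ctrl]]] := hctrl.
have [Psi [Th [W [dPsi Psi0 PsiTh dW [W0 WE]]]]] := evolution_gramian T0 cA bndA evol cB tT.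
(* A steering interval starting at t is guaranteed inside [0, T] only up to T - sigma. *)
have [tsT|tsT] := leP t (T - sigma c).
  have [|t1] := ctrl t; first by rewrite in_itv/= t0.
  rewrite in_itv/= => /andP[t01 t1s].
  have t1T : t1 <= T by rewrite (le_trans t1s)// -lerBrDr.
  rewrite -(WE _ t01 t1T) => -[Wge Wle _ _].
  have h := value_le_steered la0 lb0 lq0 lh0 lr0 gr0 gq0 symQ symR bndA bndB bndQ
    bndH bndR coeR coeQ QT_ge t0 t01 t1T dPsi Psi0 PsiTh dW W0 xi a00 a10 sg0 t1s
    Wge Wle hx lT.
  rewrite (le_trans h)// lerD2l.
  (* The premise of [steered_cost_le_c1] is found by testing the two Gramian bounds on a nonzero
     vector. *)
  have [->|xi0] := eqVneq xi 0; first by rewrite vnorm0 expr0n !mulr0.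
  rewrite ler_wpM2r ?sqr_ge0// (steered_cost_le_c1 hc)//.
  have t1in : t1 \in `[t, t1] by rewrite in_itv/= lexx andbT.
  have [_ _ hW] := steer_gramian_form la0 lb0 bndA bndB t0 t1T dPsi Psi0 PsiTh dW W0 xi t1in.
  have := Wge xi; rewrite qform_scalar qformE => /le_trans/(_ hW).
  have xi2 : 0 < dot xi xi.
    by rewrite lt_neqAle dot_ge0 andbT eq_sym; apply: contra_neq xi0; exact: dot_eq0.
  rewrite ler_pM2r// => /le_trans; apply; rewrite ler_wpM2l ?sqr_ge0//.
  rewrite ler_pM2r ?invr_gt0 ?mulr_gt0// lerD2r ler_expR ler_pM2l ?mulr_gt0//.
  by rewrite lerBlDl.
have Tts : T <= t + sigma c by rewrite -lerBlDr ltW.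
have dz s : s \in `[0, T] -> mder (fun s => Psi s *m xi) s (mA P s *m (Psi s *m xi)).
  by move=> sT; rewrite mulmxA; exact/mderMr/dPsi.
have := value_le_free la0 lq0 gr0 gq0 symQ symR symQT bndA bndQ coeR coeQ QT_ge QT_le
  hx lT t0 tT' Tts dz.
rewrite /= Psi0 mul1mx => /le_trans; apply.
by rewrite lerD2l ler_wpM2r ?sqr_ge0// (free_cost_le_c1 hc).
Qed.

Lemma perturbation_estimate d d0 l0 dT lT xs us ls xp up lp :
  bounded_measurable T d ->
  optimal_triple T P d d0 dT xs us ls ->
  optimal_triple T P d (d0 + l0) (dT + lT) xp up lp ->
  forall t : R, t \in `[0, T] ->
    vnorm (xp t - xs t) + vnorm (up t - us t) + vnorm (lp t - ls t)
    <= Lambda_b c * (vnorm l0 * expR (- (rhoZ c * t))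
                     + vnorm lT * expR (- (rhoZ c * (T - t)))).
Proof.
move=> hd hs hp t tT.
have uR s : s \in `[0, T] -> mR P s \in unitmx.
  by move=> sT; exact: coercive_unitmx gr0 (coeR sT).
have [x [u [l [hx x0 lTE E]]]] := optimal_triple_sub T0 cA cB cC cQ cH cR cG uR hd hs hp.
have [-> -> ->] := E t tT.
have c10 := c1_gt0 hc; have rho0 := rhoZ_gt0 hc.
have [] := perturbation_bound T0 lb0 gr0 gq0 symQ symR symQT bndB bndH coeR coeQ QT_ge
  (c0_gt0 hc) c10 value_lower value_upper cA cB cQ cH cR hx lTE tT.
rewrite -/(cZ c) -/(rhoZ c) x0.
have bT : vnorm ((mGT P)^T *m lT) <= lamG c * vnorm lT.
  apply: vnorm_trmx_mulmx_le (ltW lg0) _ _ => v.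
  case: hpar => _ _ _ hGT; rewrite (le_trans (vnorm_mulmx_le _ _))//.
  by rewrite ler_wpM2r ?vnorm_ge0.
set e0 := expR _; set eT := expR _.
have e00 : 0 < e0 by exact: expR_gt0. have eT0 : 0 < eT by exact: expR_gt0.
set a := vnorm l0 * e0; set b := vnorm lT * eT.
have a_ge0 : 0 <= a by rewrite mulr_ge0 ?vnorm_ge0// ltW.
have b_ge0 : 0 <= b by rewrite mulr_ge0 ?vnorm_ge0// ltW.
have bT' : vnorm ((mGT P)^T *m lT) * eT <= lamG c * b by rewrite mulrA ler_pM2r.
set z := cZ c; have z0 : 0 < z by exact: cZ_gt0.
(* M bounds the coefficients of both exponentials in the estimate of x: [cZ] for l0, and q lamG for
   lT, the factor lamG coming from GT^T lT. The bounds on l and u then follow from that on x, which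
   explains the first factor of [Lambda_b]. *)
rewrite /Lambda_b -/z; set M := Num.max _ _.
have zM : z <= M by rewrite le_max lexx.
set q := z ^+ 2 * lamB c ^+ 2 / (2 * rhoZ c * gamR c).
have q0 : 0 <= q.
  apply: divr_ge0; first exact: (mulr_ge0 (sqr_ge0 _) (sqr_ge0 _)).
  exact: (mulr_ge0 (mulr_ge0 (ler0n _ 2) (ltW rho0)) (ltW gr0)).
have qM : q * lamG c <= M.
  rewrite le_max; apply/orP; right; rewrite le_eqVlt; apply/orP; left; apply/eqP.
  by rewrite /q mulrAC.
rewrite -[z * _ * e0]mulrA -/a -[q * _ * eT]mulrA -[z * _ * eT]mulrA.
move=> hX hL hU.
have hX' : vnorm (x t) <= M * (a + b).
  rewrite (le_trans hX)// mulrDr lerD ?ler_wpM2r//.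
  by rewrite (le_trans (ler_wpM2l q0 bT'))// mulrA ler_wpM2r.
have hL' : vnorm (l t) <= (c1 c + lamG c) * (M * (a + b)).
  rewrite (le_trans hL)// mulrDl lerD ?ler_pM2l//.
  rewrite (le_trans (ler_wpM2l (ltW z0) bT'))// mulrCA ler_pM2l//.
  by rewrite ler_pM ?lerDr// ltW.
have hU' : vnorm (u t) <= lamH c / gamR c * (M * (a + b))
    + lamB c / gamR c * ((c1 c + lamG c) * (M * (a + b))).
  rewrite (le_trans hU)// mulrDl lerD// mulrAC ler_pM2l ?divr_gt0//.
by lra.
Qed.

End Estimate.

Theorem theorem5 (R : realType) (c : lq_bounds R) (hc : bounds_pos c) :
  exists Lb : R,
    [/\ Lb = Lambda_b c,
        0 < Lb &
        forall (nx nu nd : nat) (T : R) (P : lq_data R nx nu nd)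
          (d : R -> 'cV[R]_nd) (d0 l0 : 'cV[R]_nx) (dT lT : 'cV[R]_nd)
          (xs : R -> 'cV[R]_nx) (us : R -> 'cV[R]_nu) (ls : R -> 'cV[R]_nx)
          (xp : R -> 'cV[R]_nx) (up : R -> 'cV[R]_nu) (lp : R -> 'cV[R]_nx),
          symmetric_weights T P ->
          bounded_coefficients c T P ->
          uniformly_completely_controllable c T P ->
          strongly_convex_weights c T P ->
          bounded_parameter_coefficients c T P ->
          bounded_measurable T d ->
          optimal_triple T P d d0 dT xs us ls ->
          optimal_triple T P d (d0 + l0) (dT + lT) xp up lp ->
          forall t : R, t \in `[0, T] ->
            vnorm (xp t - xs t) + vnorm (up t - us t) + vnorm (lp t - ls t)
            <= Lb * (vnorm l0 * expR (- (rhoZ c * t))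
                     + vnorm lT * expR (- (rhoZ c * (T - t))))].
Proof.
exists (Lambda_b c); split => //; first exact: Lambda_b_gt0.
move=> nx nu nd T P d d0 l0 dT lT xs us ls xp up lp h1 h2 h3 h4 h5 h6 h7 h8.
by apply: (perturbation_estimate hc h1 h2 h3 h4 h5 h6 h7 h8).
Qed.
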